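(* For any $c\in\mathbb{C}$, the two categories $\mathbf{SV}(\varphi,c,* )$ and $\mathbf{SV}(c,* )$ are isomorphic. That is, there exist two functors $F_0:\mathbf{SV}(\varphi,c,* )\to\mathbf{SV}(c,* )$ and $F_\varphi:\mathbf{SV}(c,* )\to\mathbf{SV}(\varphi,c,* )$ such that $F_0\circ F_\varphi$ is the identity functor on $\mathbf{SV}(c,* )$ and $F_\varphi\circ F_0$ is the identity functor on $\mathbf{SV}(\varphi,c,* )$. Here $\mathbf{SV}(\varphi,c,* )$ is the category of ($N=1$ Neveu-Schwarz) vertex operator superalgebras over $\bigwedge_*$ with odd formal variables and with rank $c$, and $\mathbf{SV}(c,* )$ is the category of ($N=1$ Neveu-Schwarz) vertex operator superalgebras over $\bigwedge_*$ without odd formal variables and with rank $c$.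
   Context: **Grassmann algebras and conventions.** $\bigwedge_*$ denotes either $\bigwedge_L$, the exterior algebra over $\mathbb{C}$ of an $L$-dimensional complex vector space $U_L$ ($L\in\mathbb{N}$, $U_L\subset U_{L+1}$), or the direct limit $\bigwedge_\infty$ of the $\bigwedge_L$; it is $\mathbb{Z}_2$-graded, $\bigwedge_*=\bigwedge_*^0\oplus\bigwedge_*^1$. For a $\mathbb{Z}_2$-graded space, $\eta(v)=i$ for $v$ homogeneous of sign $i\in\{0,1\}$. $[A,B]$ denotes the supercommutator $AB-(-1)^{\eta(A)\eta(B)}BA$ for homogeneous $A,B$. Even formal variables ($x,x_0,x_1,x_2$) commute with everything. Odd formal variables ($\varphi,\varphi_1,\varphi_2$) commute with even variables and with even elements of $\bigwedge_*$ and even operators, anticommute with each other and with odd elements of $\bigwedge_*$ and odd operators, and square to zero. $\delta(x)=\sum_{n\in\mathbb{Z}}x^n$. Expressions such as $(x_1-x_2)^n$, $n\in\mathbb{Z}$, are expanded in nonnegative powers of the second variable, and functions of even and odd variables are expanded about the even variables: $(x_1-x_2-\varphi_1\varphi_2)^n=(x_1-x_2)^n-n\varphi_1\varphi_2(x_1-x_2)^{n-1}$, so $\delta\left(\frac{x_1-x_2-\varphi_1\varphi_2}{x_0}\right)=\sum_{n\in\mathbb{Z}}(x_1-x_2-\varphi_1\varphi_2)^nx_0^{-n}$, and similarly for other such expressions. $Y$ is extended linearly to series with formal-variable coefficients. **Vertex operator superalgebra over $\bigwedge_*$ with odd formal variables.** This is a $\frac12\mathbb{Z}$-graded (by weight)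 $\bigwedge_*$-module, also $\mathbb{Z}_2$-graded (by sign), $V=\coprod_{n\in\frac12\mathbb{Z}}V_{(n)}=\coprod_{n}V^0_{(n)}\oplus\coprod_nV^1_{(n)}=V^0\oplus V^1$, with $\dim V_{(n)}<\infty$ for all $n\in\frac12\mathbb{Z}$ and $V_{(n)}=0$ for $n$ sufficiently small (positive energy), equipped with a linear map $V\otimes V\to V[[x,x^{-1}]][\varphi]$, equivalently $V\to(\mathrm{End}\,V)[[x,x^{-1}]][\varphi]$, $v\mapsto Y(v,(x,\varphi))=\sum_{n\in\mathbb{Z}}v_nx^{-n-1}+\varphi\sum_{n\in\mathbb{Z}}v_{n-\frac12}x^{-n-1}$, where $v_n\in(\mathrm{End}\,V)^{\eta(v)}$ and $v_{n-\frac12}\in(\mathrm{End}\,V)^{(\eta(v)+1)\bmod 2}$ for $v$ of homogeneous sign, and with distinguished vectors $\mathbf{1}\in V^0_{(0)}$ (vacuum) and $\tau\in V^1_{(3/2)}$ (Neveu-Schwarz element), such that for $u,v\in V$: (1) (truncation) $u_nv=0$ for $n\in\frac12\mathbb{Z}$ sufficiently large; (2) $Y(\mathbf{1},(x,\varphi))=1$; (3) (creation) $Y(v,(x,\varphi))\mathbf{1}\in V[[x]][\varphi]$ and $\lim_{(x,\varphi)\to0}Y(v,(x,\varphi))\mathbf{1}=v$; (4) (Jacobi identity) for $u,v$ of homogeneous sign, $$x_0^{-1}\delta\left(\tfrac{x_1-x_2-\varphi_1\varphi_2}{x_0}\right)Y(u,(x_1,\varphi_1))Y(v,(x_2,\varphi_2))-(-1)^{\eta(u)\eta(v)}x_0^{-1}\delta\left(\tfrac{x_2-x_1+\varphi_1\varphi_2}{-x_0}\right)Y(v,(x_2,\varphi_2))Y(u,(x_1,\varphi_1))$$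 $$=x_2^{-1}\delta\left(\tfrac{x_1-x_0-\varphi_1\varphi_2}{x_2}\right)Y(Y(u,(x_0,\varphi_1-\varphi_2))v,(x_2,\varphi_2));$$ (5) (Neveu-Schwarz relations) with $G(n+\frac12)=\tau_{n+1}$ and $2L(n)=\tau_{n+\frac12}$ for $n\in\mathbb{Z}$, one has for $m,n\in\mathbb{Z}$: $[L(m),L(n)]=(m-n)L(m+n)+\frac1{12}(m^3-m)\delta_{m+n,0}(\mathrm{rank}\,V)$, $[G(m+\frac12),L(n)]=(m-\frac{n-1}{2})G(m+n+\frac12)$, $[G(m+\frac12),G(n-\frac12)]=2L(m+n)+\frac13(m^2+m)\delta_{m+n,0}(\mathrm{rank}\,V)$, where $\mathrm{rank}\,V\in\mathbb{C}$; (6) $L(0)v=nv$ for $n\in\frac12\mathbb{Z}$ and $v\in V_{(n)}$; (7) ($G(-\frac12)$-derivative property) $\left(\frac{\partial}{\partial\varphi}+\varphi\frac{\partial}{\partial x}\right)Y(v,(x,\varphi))=Y(G(-\tfrac12)v,(x,\varphi))$. It is denoted $(V,Y(\cdot,(x,\varphi)),\mathbf{1},\tau)$. **Vertex operator superalgebra over $\bigwedge_*$ without odd formal variables.** This is a $\bigwedge_*$-module $V$ with the same gradings, finite-dimensionality and positive-energy conditions, equipped with a linear map $V\otimes V\to V[[x,x^{-1}]]$, equivalently $v\mapsto Y(v,x)=\sum_{n\in\mathbb{Z}}v_nx^{-n-1}\in(\mathrm{End}\,V)[[x,x^{-1}]]$ with $v_n\in(\mathrm{End}\,V)^{\eta(v)}$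 for $v$ of homogeneous sign, and with $\mathbf{1}\in V^0_{(0)}$, $\tau\in V^1_{(3/2)}$, such that for $u,v\in V$: $u_nv=0$ for $n\in\mathbb{Z}$ sufficiently large; $Y(\mathbf{1},x)=1$; $Y(v,x)\mathbf{1}\in V[[x]]$ and $\lim_{x\to0}Y(v,x)\mathbf{1}=v$; for $u,v$ of homogeneous sign the Jacobi identity $$x_0^{-1}\delta\left(\tfrac{x_1-x_2}{x_0}\right)Y(u,x_1)Y(v,x_2)-(-1)^{\eta(u)\eta(v)}x_0^{-1}\delta\left(\tfrac{x_2-x_1}{-x_0}\right)Y(v,x_2)Y(u,x_1)=x_2^{-1}\delta\left(\tfrac{x_1-x_0}{x_2}\right)Y(Y(u,x_0)v,x_2);$$ the Neveu-Schwarz relations displayed in (5) hold with $G(n+\frac12)=\tau_{n+1}$ and operators $L(n)$, $n\in\mathbb{Z}$ (determined by the third relation), and $\mathrm{rank}\,V\in\mathbb{C}$; $L(0)v=nv$ for $v\in V_{(n)}$; and $\frac{\partial}{\partial x}Y(v,x)=Y(L(-1)v,x)$. It is denoted $(V,Y(\cdot,x),\mathbf{1},\tau)$. **Morphisms.** A homomorphism of vertex operator superalgebras with odd formal variables is a doubly graded $\bigwedge_*$-module homomorphism $\gamma:V_1\to V_2$ (i.e. $\gamma((V_1)^i_{(n)})\subset(V_2)^i_{(n)}$ for $n\in\frac12\mathbb{Z}$, $i\in\mathbb{Z}_2$) with $\gamma(Y_1(u,(x,\varphi))v)=Y_2(\gamma(u),(x,\varphi))\gamma(v)$ for $u,v\in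 V_1$, $\gamma(\mathbf{1}_1)=\mathbf{1}_2$ and $\gamma(\tau_1)=\tau_2$. A homomorphism of vertex operator superalgebras without odd formal variables is a doubly graded $\bigwedge_*$-module homomorphism $\gamma:V_1\to V_2$ with $\gamma(Y_1(u,x)v)=Y_2(\gamma(u),x)\gamma(v)$ for $u,v\in V_1$, $\gamma(\mathbf{1}_1)=\mathbf{1}_2$ and $\gamma(\tau_1)=\tau_2$. The rank of an object is also called its central charge. *)

(* Defs.v *)
From HB Require Import structures.
From mathcomp Require Import all_boot all_order all_algebra finmap.
From mathcomp Require Import monalg complex.
From mathcomp Require Import boolp classical_sets functions cardinality fsbigop reals.

Set Implicit Arguments.
Unset Strict Implicit.
Unset Printing Implicit Defensive.

Import Order.TTheory GRing.Theory Num.Theory.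

Local Open Scope fset_scope.
Local Open Scope ring_scope.

(* The Grassmann algebra is built uniformly: s = Some L stands for the exterior
   algebra on L generators, and s = None for the direct limit over L, with
   generators indexed by nat.  A basis consists of the monomials
   xi_(i_1) ... xi_(i_k), i_1 < ... < i_k, indexed by finite sets {i_1, ..., i_k}. *)
Definition below (s : option nat) : pred nat :=
  fun i => if s is Some L then (i < L)%N else true.
Definition gen (s : option nat) : Type := {i : nat | below s i}.
HB.instance Definition _ s := Choice.copy (gen s) {i : nat | below s i}.

Lemma sum_fsetU (I : choiceType) (A B : {fset I}) (F : I -> nat) :
  [disjoint A & B]%fset ->
  (\sum_(i <- A `|` B) F i = \sum_(i <- A) F i + \sum_(i <- B) F i)%N.
Proof.
move=> dAB; rewrite -big_cat /=; apply: perm_big.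
apply: uniq_perm; rewrite ?fset_uniq //; last first.
  by move=> i; rewrite mem_cat inE.
rewrite cat_uniq !fset_uniq andbT /=; apply/hasPn => i iB.
by apply: contraL iB => /(fdisjointP dAB).
Qed.

Section Grassmann.
Context (K : comNzRingType) (s : option nat).
Implicit Types (S T U : {fset gen s}).

Definition inversions S T : nat :=
  (\sum_(i <- S) \sum_(j <- T) (val j < val i))%N.

(* xi_S xi_T = merge_sign S T xi_(S `|` T) *)
Definition merge_sign S T : K :=
  if [disjoint S & T]%fset then (-1) ^+ inversions S T else 0.

Lemma merge_sign0X T : merge_sign fset0 T = 1.
Proof. by rewrite /merge_sign fdisjoint0X /inversions big_seq_fset0. Qed.

Lemma merge_signX0 S : merge_sign S fset0 = 1.
Proof.
rewrite /merge_sign fdisjointX0 /inversions big1 // => i _.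
by rewrite big_seq_fset0.
Qed.

Lemma inversionsUl S T U : [disjoint S & T]%fset ->
  inversions (S `|` T) U = (inversions S U + inversions T U)%N.
Proof. by move=> dST; rewrite /inversions sum_fsetU. Qed.

Lemma inversionsUr S T U : [disjoint T & U]%fset ->
  inversions S (T `|` U) = (inversions S T + inversions S U)%N.
Proof.
move=> dTU; rewrite /inversions -big_split; apply: eq_bigr => i _ /=.
by rewrite sum_fsetU.
Qed.

Lemma merge_signA S T U :
  merge_sign S T * merge_sign (S `|` T) U =
  merge_sign T U * merge_sign S (T `|` U).
Proof.
rewrite /merge_sign fdisjointUX fdisjointXU.
have [dST|_] := boolP [disjoint S & T]%fset; last by rewrite mul0r /= mulr0.
have [dTU|_] := boolP [disjoint T & U]%fset; last by rewrite andbF mul0r mulr0.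
rewrite andbT /=; case: ifP => _; last by rewrite !mulr0.
rewrite inversionsUl // inversionsUr // -!exprD.
by congr (_ ^+ _); rewrite addnA addnC.
Qed.

Definition grassmann : Type := {malg K[{fset gen s}]}.
HB.instance Definition _ := GRing.Lmodule.on grassmann.

Implicit Types (f g h : grassmann).

Definition gmul f g : grassmann :=
  \sum_(S <- msupp f) \sum_(T <- msupp g)
    << merge_sign S T * (f@_S * g@_T) *g S `|` T >>.

Lemma gmulE (d1 d2 : {fset {fset gen s}}) f g :
  msupp f `<=` d1 -> msupp g `<=` d2 ->
  gmul f g = \sum_(S <- d1) \sum_(T <- d2)
    << merge_sign S T * (f@_S * g@_T) *g S `|` T >>.
Proof.
move=> le1 le2; rewrite /gmul (big_fset_incl _ le1) /=.
  apply/eq_bigr=> S _; apply/big_fset_incl => // T _ /mcoeff_outdom ->.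
  by rewrite !mulr0 monalgU0.
move=> S _ /mcoeff_outdom fS.
by rewrite big1 // => T _; rewrite fS mul0r mulr0 monalgU0.
Qed.

Lemma gmulDl : left_distributive gmul +%R.
Proof.
move=> f g h; rewrite (gmulE (msuppD_le f g) (fsubset_refl (msupp h))).
rewrite (gmulE (fsubsetUl (msupp f) (msupp g)) (fsubset_refl (msupp h))).
rewrite (gmulE (fsubsetUr (msupp f) (msupp g)) (fsubset_refl (msupp h))).
rewrite -big_split /=; apply/eq_bigr=> S _.
rewrite -big_split /=; apply/eq_bigr=> T _.
by rewrite mcoeffD mulrDl mulrDr monalgUD.
Qed.

Lemma gmulDr : right_distributive gmul +%R.
Proof.
move=> h f g; rewrite (gmulE (fsubset_refl (msupp h)) (msuppD_le f g)).
rewrite (gmulE (fsubset_refl (msupp h)) (fsubsetUl (msupp f) (msupp g))).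
rewrite (gmulE (fsubset_refl (msupp h)) (fsubsetUr (msupp f) (msupp g))).
rewrite -big_split /=; apply/eq_bigr=> S _.
rewrite -big_split /=; apply/eq_bigr=> T _.
by rewrite mcoeffD !mulrDr monalgUD.
Qed.

Lemma gmul0g : left_zero 0 gmul.
Proof. by move=> f; rewrite /gmul msupp0 big_seq_fset0. Qed.

Lemma gmulg0 : right_zero 0 gmul.
Proof.
by move=> f; rewrite /gmul big1 // => S _; rewrite msupp0 big_seq_fset0.
Qed.

Lemma gmulUU (a b : K) S T :
  gmul << a *g S >> << b *g T >> =
  << merge_sign S T * (a * b) *g S `|` T >>.
Proof. by rewrite (gmulE msuppU_le msuppU_le) !big_seq_fset1 !mcoeffUU. Qed.

Lemma gmul_suml I (r : seq I) (F : I -> grassmann) g :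
  gmul (\sum_(i <- r) F i) g = \sum_(i <- r) gmul (F i) g.
Proof. exact: (big_morph (gmul^~ g) (fun _ _ => gmulDl _ _ _) (gmul0g _)). Qed.

Lemma gmul_sumr I (r : seq I) (F : I -> grassmann) f :
  gmul f (\sum_(i <- r) F i) = \sum_(i <- r) gmul f (F i).
Proof. exact: (big_morph (gmul f) (fun _ _ => gmulDr _ _ _) (gmulg0 _)). Qed.

Lemma gmulEl f g : gmul f g = \sum_(S <- msupp f) gmul << f@_S *g S >> g.
Proof. by rewrite -gmul_suml -monalgE. Qed.

Lemma gmulEr f g : gmul f g = \sum_(T <- msupp g) gmul f << g@_T *g T >>.
Proof. by rewrite -gmul_sumr -monalgE. Qed.

Lemma gmulA : associative gmul.
Proof.
move=> f g h; rewrite (gmulEl f (gmul g h)) (gmulEl f g) gmul_suml.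
apply/eq_bigr => S _.
rewrite (gmulEl g h) (gmulEr _ g) gmul_sumr gmul_suml; apply/eq_bigr => T _.
rewrite (gmulEr _ h) gmul_sumr [RHS](gmulEr _ h); apply/eq_bigr => U _.
rewrite !gmulUU fsetUA; congr << _ *g _ >>.
set a := f@_S; set b := g@_T; set c := h@_U.
transitivity (merge_sign T U * merge_sign S (T `|` U) * (a * b * c)).
  by rewrite (mulrCA a) mulrA [in RHS](mulrC (merge_sign T U)) !mulrA.
by rewrite -merge_signA -!mulrA mulrCA.
Qed.

Definition gone : grassmann := << fset0 >>.

Lemma gmul1g : left_id gone gmul.
Proof.
move=> g; rewrite [in LHS](monalgE g) gmul_sumr [RHS]monalgE.
apply/eq_bigr => S _.
by rewrite gmulUU merge_sign0X fset0U !mul1r.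
Qed.

Lemma gmulg1 : right_id gone gmul.
Proof.
move=> g; rewrite [in LHS](monalgE g) gmul_suml [RHS]monalgE.
apply/eq_bigr => S _.
by rewrite gmulUU merge_signX0 fsetU0 mul1r mulr1.
Qed.

Lemma gone_neq0 : gone != 0.
Proof. by apply/eqP/malgP=> /(_ fset0) /eqP; rewrite !mcoeffsE oner_eq0. Qed.

HB.instance Definition _ := GRing.Zmodule_isNzRing.Build grassmann
  gmulA gmul1g gmulg1 gmulDl gmulDr gone_neq0.

Lemma gscaleU (a b : K) S : a *: << b *g S >> = << a * b *g S >> :> grassmann.
Proof. by apply/malgP => T; rewrite mcoeffZ !mcoeffU mulrnAr. Qed.

Lemma gscaleAl (c : K) f g : c *: (f * g) = (c *: f) * g.
Proof.
rewrite -[f * g]/(gmul f g) -[_ * g]/(gmul (c *: f) g).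
have EcF : c *: f = \sum_(S <- msupp f) << c * f@_S *g S >>.
  by rewrite {1}(monalgE f) scaler_sumr; apply/eq_bigr => S _; rewrite gscaleU.
rewrite EcF gmul_suml gmulEl scaler_sumr; apply/eq_bigr => S _.
rewrite gmulEr [RHS]gmulEr scaler_sumr; apply/eq_bigr => T _.
by rewrite !gmulUU gscaleU mulrCA !mulrA.
Qed.

HB.instance Definition _ := GRing.Lmodule_isLalgebra.Build K grassmann gscaleAl.

(* The even (i = false) and odd (i = true) parts. *)
Definition gsign (i : bool) : set grassmann :=
  [set a : grassmann | forall S, a@_S != 0 -> odd #|` S| = i]%classic.

(* The defining relations of the exterior algebra. *)
Definition gvar (i : gen s) : grassmann := << [fset i] >>.

Lemma gvar2 i : gvar i * gvar i = 0.
Proof.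
rewrite /GRing.mul /= gmulUU /merge_sign fdisjoint1X inE eqxx mul0r.
exact: monalgU0.
Qed.

Lemma gvarC i j : gvar i * gvar j = - (gvar j * gvar i).
Proof.
have [->|ij] := eqVneq i j; first by rewrite gvar2 oppr0.
rewrite /GRing.mul /= !gmulUU fsetUC -monalgUN !mul1r !mulr1; congr << _ *g _ >>.
rewrite /merge_sign !fdisjoint1X !inE (eq_sym j i) ij /inversions !big_seq_fset1.
have : val i != val j by [].
by case: ltngtP => //= _ _; rewrite ?opprK.
Qed.

End Grassmann.

Section FormalSeries.
Context (K : fieldType).

Definition sgnb (M : zmodType) (b : bool) (x : M) : M := if b then - x else x.

Definition gbinom (n : int) (k : nat) : K :=
  (\prod_(j < k) (n%:~R - j%:R)) / k`!%:R.

(* The coefficient of x^a y^b in (x - y)^n, expanded in nonnegative powers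
   of y. *)
Definition bpow (n a b : int) : K :=
  if (0 <= b) && (a + b == n) then (-1) ^+ `|b|%N * gbinom n `|b|%N else 0.

(* M[phi1, phi2]: the value at (p, q) is the coefficient of phi1^p phi2^q, the
   odd variables being written to the left of the coefficients. *)
Notation odd2 M := {ffun bool * bool -> M}.

Definition oconst (M : zmodType) (x : M) : odd2 M :=
  [ffun b => if b == (false, false) then x else 0].

Definition phi1 (M : zmodType) (f : odd2 M) : odd2 M :=
  [ffun b => if b.1 then f (false, b.2) else 0].

Definition phi2 (M : zmodType) (f : odd2 M) : odd2 M :=
  [ffun b => if b.2 then sgnb b.1 (f (b.1, false)) else 0].

(* The extension to M[phi1, phi2] of an operator T of sign p, which has to be
   moved past the odd variables. *)
Definition oext (M : zmodType) (p : bool) (T : M -> M) (f : odd2 M) : odd2 M :=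
  [ffun b => sgnb (p && (b.1 (+) b.2)) (T (f b))].

(* The coefficient of x^a y^b in
     (x - y + eps phi1 phi2)^n = (x - y)^n + eps n phi1 phi2 (x - y)^(n - 1). *)
Definition opow (eps : K) (n a b : int) : odd2 K :=
  oconst (bpow n a b) +
  phi1 (phi2 (oconst (eps * n%:~R * bpow (n - 1) a b))).

(* A series in x0, x1, x2 and their inverses is the function that maps the exponents
   (e0, e1, e2) to the coefficient of x0^e0 x1^e1 x2^e2. *)
Notation expo := (int * int * int)%type.

(* Multiplication by x0^d0 x1^d1 x2^d2. *)
Definition xshift (M : Type) (d : expo) (f : expo -> M) : expo -> M :=
  fun e => f (e - d).

(* \sum_(d \in _) is the sum of a finitely supported family; all the products
   formed below have this property because of the truncation condition. *)
Definition sprod (A B : Type) (M : zmodType) (op : A -> B -> M)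
    (f : expo -> A) (g : expo -> B) : expo -> M :=
  fun e => \sum_(d \in [set: expo]) op (f d) (g (e - d)).

(* delta ((x1 - x2) / x0), delta ((x2 - x1) / - x0), delta ((x1 - x0) / x2) *)
Definition delta12_0 : expo -> K := fun e => bpow (- e.1.1) e.1.2 e.2.
Definition delta21_0 : expo -> K :=
  fun e => (-1) ^ e.1.1 * bpow (- e.1.1) e.2 e.1.2.
Definition delta10_2 : expo -> K := fun e => bpow (- e.2) e.1.2 e.1.1.

(* delta ((x1 - x2 - phi1 phi2) / x0), delta ((x2 - x1 + phi1 phi2) / - x0),
   delta ((x1 - x0 - phi1 phi2) / x2) *)
Definition odelta12_0 : expo -> odd2 K :=
  fun e => opow (-1) (- e.1.1) e.1.2 e.2.
Definition odelta21_0 : expo -> odd2 K :=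
  fun e => [ffun b => (-1) ^ e.1.1 * opow 1 (- e.1.1) e.2 e.1.2 b].
Definition odelta10_2 : expo -> odd2 K :=
  fun e => opow (-1) (- e.2) e.1.2 e.1.1.

End FormalSeries.

Notation expo := (int * int * int)%type.
Notation odd2 M := {ffun bool * bool -> M}.
Notation x0inv := (xshift (-1, 0, 0)).
Notation x2inv := (xshift (0, 0, -1)).

Section SuperModules.
Context (R : realType) (s : option nat).
Local Notation C := R[i].
Local Notation Lambda := (grassmann C s).

(* comp k i is the component of weight k/2 and sign i. *)
Definition weight_space (V : lmodType Lambda) (comp : int -> bool -> set V)
    (k : int) : set V :=
  [set v | exists2 v0, comp k false v0 &
    exists2 v1, comp k true v1 & v = v0 + v1]%classic.

Definition sign_space (V : lmodType Lambda) (comp : int -> bool -> set V)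
    (i : bool) : set V :=
  [set v | exists f : int -> V,
     [/\ finite_set [set k | f k != 0], forall k, comp k i (f k) &
         v = \sum_(k \in [set: int]) f k]]%classic.

Record graded_axioms (V : lmodType Lambda) (comp : int -> bool -> set V) : Prop := {
  comp0 : forall k i, comp k i 0;
  compB : forall k i u v, comp k i u -> comp k i v -> comp k i (u - v);
  compZ : forall k i j (a : Lambda) v,
    gsign i a -> comp k j v -> comp k (i (+) j) (a *: v);
  comp_direct : forall v, exists! f : int * bool -> V,
    [/\ finite_set [set p | f p != 0]%classic, forall p, comp p.1 p.2 (f p) &
        v = \sum_(p \in [set: int * bool]%classic) f p];
  (* dim V_(k/2) < oo, as a module over the Grassmann algebra *)
  weight_finite : forall k, exists r : seq V,
    (forall x, x \in r -> weight_space comp k x) /\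
    forall v, weight_space comp k v ->
      exists a : nat -> Lambda, v = \sum_(i < size r) a i *: r`_i;
  positive_energy : exists N, forall k v,
    k < N -> weight_space comp k v -> v = 0
}.

Record gmodule := GModule {
  gsort :> lmodType Lambda;
  gcomp : int -> bool -> set gsort;
  _ : graded_axioms gcomp
}.

Section Operators.
Context (V : gmodule).
Local Notation sgn_ i := (sign_space (@gcomp V) i).

(* The action of complex scalars. *)
Definition cscale (c : C) (v : V) : V := (c%:A : Lambda) *: v.

(* T belongs to (End V)^p; endomorphisms are linear over the Grassmann algebra
   in the super sense, T (a v) = (-1)^(eta(T) eta(a)) a T(v). *)
Record is_end (p : bool) (T : V -> V) : Prop := {
  end_add : forall u v, T (u + v) = T u + T v;
  end_scale : forall i (a : Lambda) v, gsign i a ->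
    T (a *: v) = sgnb (p && i) (a *: T v);
  end_sign : forall i v, sgn_ i v -> sgn_ (p (+) i) (T v)
}.

Definition supercomm (p q : bool) (A B : V -> V) : V -> V :=
  fun v => A (B v) - sgnb (p && q) (B (A v)).

(* G n stands for G(n + 1/2). *)
Record neveu_schwarz (c : C) (L G : int -> V -> V) : Prop := {
  ns_LL : forall m n v,
    supercomm false false (L m) (L n) v =
    cscale (m - n)%:~R (L (m + n) v) +
    cscale ((m ^+ 3 - m)%:~R / 12%:R * (m + n == 0)%:R * c) v;
  ns_GL : forall m n v,
    supercomm true false (G m) (L n) v =
    cscale (m%:~R - (n - 1)%:~R / 2%:R) (G (m + n) v);
  ns_GG : forall m n v,
    supercomm true true (G m) (G (n - 1)) v =
    cscale 2%:R (L (m + n) v) +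
    cscale ((m ^+ 2 + m)%:~R / 3%:R * (m + n == 0)%:R * c) v
}.

End Operators.

Section WithoutOddVariables.
Context (V : gmodule).
Local Notation sgn_ i := (sign_space (@gcomp V) i).

(* Y u v k is the coefficient of x^k in Y(u, x)v. *)
Implicit Type Y : V -> V -> int -> V.

Definition mode Y (u : V) (n : int) (v : V) : V := Y u v (- n - 1).

(* Y(u, x1) Y(v, x2) w, Y(v, x2) Y(u, x1) w and Y(Y(u, x0) v, x2) w *)
Definition Y1Y2 Y (u v w : V) : expo -> V :=
  fun e => if e.1.1 == 0 then Y u (Y v w e.2) e.1.2 else 0.
Definition Y2Y1 Y (u v w : V) : expo -> V :=
  fun e => if e.1.1 == 0 then Y v (Y u w e.1.2) e.2 else 0.
Definition YY Y (u v w : V) : expo -> V :=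
  fun e => if e.1.2 == 0 then Y (Y u v e.1.1) w e.2 else 0.

Record vosa_axioms (c : C) Y (one tau : V) : Prop := {
  v_addl : forall u u' v k, Y (u + u') v k = Y u v k + Y u' v k;
  v_scalel : forall (a : Lambda) u v k, Y (a *: u) v k = a *: Y u v k;
  v_mode : forall i u n, sgn_ i u -> is_end i (mode Y u n);
  v_one : gcomp 0 false one;
  v_tau : gcomp 3 true tau;
  v_trunc : forall u v, exists N : int, forall n, N <= n -> mode Y u n v = 0;
  v_vacuum : forall v k, Y one v k = if k == 0 then v else 0;
  v_create : forall v,
    (forall k : int, k < 0 -> Y v one k = 0) /\ Y v one 0 = v;
  v_jacobi : forall i j u v w e, sgn_ i u -> sgn_ j v ->
    sprod (@cscale V) (x0inv (delta12_0 C)) (Y1Y2 Y u v w) e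
    - sgnb (i && j)
        (sprod (@cscale V) (x0inv (delta21_0 C)) (Y2Y1 Y u v w) e)
    = sprod (@cscale V) (x2inv (delta10_2 C)) (YY Y u v w) e;
  v_ns : exists L : int -> V -> V,
    [/\ forall n, is_end false (L n),
        neveu_schwarz c L (fun n => mode Y tau (n + 1)),
        forall k v, weight_space (@gcomp V) k v ->
          L 0 v = cscale (k%:~R / 2%:R) v &
        forall u v k, Y u v (k + 1) *~ (k + 1) = Y (L (-1) u) v k]
}.

End WithoutOddVariables.

Section WithOddVariables.
Context (V : gmodule).
Local Notation sgn_ i := (sign_space (@gcomp V) i).

(* Y u v b k is the coefficient of phi^b x^k in Y(u, (x, phi))v. *)
Implicit Type Y : V -> V -> bool -> int -> V.

(* u_n and u_(n - 1/2), for n an integer *)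
Definition imode Y (u : V) (n : int) (v : V) : V := Y u v false (- n - 1).
Definition hmode Y (u : V) (n : int) (v : V) : V := Y u v true (- n - 1).

(* G(n + 1/2) and L(n) *)
Definition oG Y (tau : V) (n : int) : V -> V := imode Y tau (n + 1).
Definition oL Y (tau : V) (n : int) (v : V) : V :=
  cscale 2%:R^-1 (hmode Y tau (n + 1) v).

(* C[phi1, phi2] acting on V[phi1, phi2] *)
Definition oscale (f : odd2 C) (g : odd2 V) : odd2 V :=
  \sum_(b : bool * bool)
     (f b)%:A *: iter b.1 (@phi1 V) (iter b.2 (@phi2 V) g).

(* The coefficient of x^k in Y(u, (x, phi)), for u of sign p, as an operator on
   V[phi1, phi2]; phi is phi1 or phi2. *)
Definition Yop (phi : odd2 V -> odd2 V) Y (p : bool) (u : V) (k : int)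
    (f : odd2 V) : odd2 V :=
  oext p (fun w => Y u w false k) f +
  phi (oext (~~ p) (fun w => Y u w true k) f).

(* Y(u, (x1, phi1)) Y(v, (x2, phi2)) w and Y(v, (x2, phi2)) Y(u, (x1, phi1)) w,
   for u of sign i and v of sign j *)
Definition oY1Y2 Y (i j : bool) (u v w : V) : expo -> odd2 V :=
  fun e => if e.1.1 == 0
    then Yop (@phi1 V) Y i u e.1.2 (Yop (@phi2 V) Y j v e.2 (oconst w)) else 0.
Definition oY2Y1 Y (i j : bool) (u v w : V) : expo -> odd2 V :=
  fun e => if e.1.1 == 0
    then Yop (@phi2 V) Y j v e.2 (Yop (@phi1 V) Y i u e.1.2 (oconst w)) else 0.

(* The coefficient of x0^k in Y(u, (x0, phi1 - phi2)) v *)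
Definition Ydiff Y (u v : V) (k : int) : odd2 V :=
  oconst (Y u v false k) +
  (phi1 (oconst (Y u v true k)) - phi2 (oconst (Y u v true k))).

(* The coefficient of x2^k in Y(f, (x2, phi2)) w, where Y is extended linearly
   to f in V[phi1, phi2] *)
Definition Ylin Y (f : odd2 V) (w : V) (k : int) : odd2 V :=
  \sum_(b : bool * bool) iter b.1 (@phi1 V) (iter b.2 (@phi2 V)
     (oconst (Y (f b) w false k) + phi2 (oconst (Y (f b) w true k)))).

(* Y(Y(u, (x0, phi1 - phi2)) v, (x2, phi2)) w *)
Definition oYY Y (u v w : V) : expo -> odd2 V :=
  fun e => if e.1.2 == 0 then Ylin Y (Ydiff Y u v e.1.1) w e.2 else 0.

(* d/dphi + phi d/dx on V[[x, x^-1]][phi] *)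
Definition oderiv (f : bool -> int -> V) : bool -> int -> V :=
  fun b k => if b then f false (k + 1) *~ (k + 1) else f true k.

Record ovosa_axioms (c : C) Y (one tau : V) : Prop := {
  o_addl : forall u u' v b k, Y (u + u') v b k = Y u v b k + Y u' v b k;
  (* the sign comes from a phi = - phi a for a odd *)
  o_scalel : forall i (a : Lambda) u v b k, gsign i a ->
    Y (a *: u) v b k = sgnb (i && b) (a *: Y u v b k);
  o_imode : forall i u n, sgn_ i u -> is_end i (imode Y u n);
  o_hmode : forall i u n, sgn_ i u -> is_end (~~ i) (hmode Y u n);
  o_one : gcomp 0 false one;
  o_tau : gcomp 3 true tau;
  o_trunc : forall u v, exists N : int, forall n, N <= n ->
    imode Y u n v = 0 /\ hmode Y u n v = 0;
  o_vacuum : forall v b k,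
    Y one v b k = if ~~ b && (k == 0) then v else 0;
  o_create : forall v,
    (forall b (k : int), k < 0 -> Y v one b k = 0) /\ Y v one false 0 = v;
  o_jacobi : forall i j u v w e, sgn_ i u -> sgn_ j v ->
    sprod oscale (x0inv (odelta12_0 C)) (oY1Y2 Y i j u v w) e
    - sgnb (i && j)
        (sprod oscale (x0inv (odelta21_0 C)) (oY2Y1 Y i j u v w) e)
    = sprod oscale (x2inv (odelta10_2 C)) (oYY Y u v w) e;
  o_ns : neveu_schwarz c (oL Y tau) (oG Y tau);
  o_L0 : forall k v, weight_space (@gcomp V) k v ->
    oL Y tau 0 v = cscale (k%:~R / 2%:R) v;
  o_deriv : forall u v b k, oderiv (Y u v) b k = Y (oG Y tau (-1) u) v b k
}.

End WithOddVariables.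

(* The objects of rank c. *)
Record vosa (c : C) := Vosa {
  v_mod :> gmodule;
  v_Y : v_mod -> v_mod -> int -> v_mod;
  v_1 : v_mod;
  v_t : v_mod;
  _ : vosa_axioms c v_Y v_1 v_t
}.

Record ovosa (c : C) := OVosa {
  o_mod :> gmodule;
  o_Y : o_mod -> o_mod -> bool -> int -> o_mod;
  o_1 : o_mod;
  o_t : o_mod;
  _ : ovosa_axioms c o_Y o_1 o_t
}.

Record vosa_hom_axioms (c : C) (V W : vosa c) (f : V -> W) : Prop := {
  vh_add : forall u v, f (u + v) = f u + f v;
  vh_scale : forall (a : Lambda) v, f (a *: v) = a *: f v;
  vh_comp : forall k i v, gcomp k i v -> gcomp k i (f v);
  vh_Y : forall u v k, f (v_Y u v k) = v_Y (f u) (f v) k;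
  vh_1 : f (v_1 V) = v_1 W;
  vh_t : f (v_t V) = v_t W
}.

Record ovosa_hom_axioms (c : C) (V W : ovosa c) (f : V -> W) : Prop := {
  oh_add : forall u v, f (u + v) = f u + f v;
  oh_scale : forall (a : Lambda) v, f (a *: v) = a *: f v;
  oh_comp : forall k i v, gcomp k i v -> gcomp k i (f v);
  oh_Y : forall u v b k, f (o_Y u v b k) = o_Y (f u) (f v) b k;
  oh_1 : f (o_1 V) = o_1 W;
  oh_t : f (o_t V) = o_t W
}.

Record vosa_hom (c : C) (V W : vosa c) := VosaHom {
  vhom_fun :> V -> W;
  _ : vosa_hom_axioms vhom_fun
}.

Record ovosa_hom (c : C) (V W : ovosa c) := OVosaHom {
  ohom_fun :> V -> W;
  _ : ovosa_hom_axioms ohom_fun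
}.

End SuperModules.

Record category := Category {
  obj : Type;
  hom : obj -> obj -> Type;
  idc : forall X, hom X X;
  compc : forall X Y Z, hom Y Z -> hom X Y -> hom X Z;
  compc1 : forall X Y (f : hom X Y), compc f (idc X) = f;
  comp1c : forall X Y (f : hom X Y), compc (idc Y) f = f;
  compcA : forall X Y Z T (h : hom Z T) (g : hom Y Z) (f : hom X Y),
    compc h (compc g f) = compc (compc h g) f
}.

Record functor (A B : category) := Functor {
  fobj : obj A -> obj B;
  fmap : forall X Y, hom X Y -> hom (fobj X) (fobj Y);
  fmap1 : forall X, fmap (idc X) = idc (fobj X);
  fmapM : forall X Y Z (g : hom Y Z) (f : hom X Y),
    fmap (compc g f) = compc (fmap g) (fmap f)
}.

Definition functor_id (A : category) : functor A A :=
  @Functor A A id (fun _ _ => id) (fun _ => erefl) (fun _ _ _ _ _ => erefl).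

Lemma fcomp1 (A B D : category) (F : functor B D) (G : functor A B) X :
  fmap F (fmap G (idc X)) = idc (fobj F (fobj G X)).
Proof. by rewrite !fmap1. Qed.

Lemma fcompM (A B D : category) (F : functor B D) (G : functor A B) X Y Z
    (g : hom Y Z) (f : hom X Y) :
  fmap F (fmap G (compc g f)) = compc (fmap F (fmap G g)) (fmap F (fmap G f)).
Proof. by rewrite !fmapM. Qed.

Definition functor_comp (A B D : category) (F : functor B D)
    (G : functor A B) : functor A D :=
  @Functor A D (fun X => fobj F (fobj G X))
    (fun _ _ f => fmap F (fmap G f)) (fcomp1 F G) (@fcompM _ _ _ F G).

Section Categories.
Context (R : realType) (s : option nat) (c : R[i]).

Lemma vosa_hom_eq (V W : vosa s c) (f g : vosa_hom V W) : f =1 g -> f = g.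
Proof.
case: f g => [f pf] [g pg] /= /funext fg; case: _ / fg in pg *.
by congr VosaHom; exact: Prop_irrelevance.
Qed.

Lemma ovosa_hom_eq (V W : ovosa s c) (f g : ovosa_hom V W) : f =1 g -> f = g.
Proof.
case: f g => [f pf] [g pg] /= /funext fg; case: _ / fg in pg *.
by congr OVosaHom; exact: Prop_irrelevance.
Qed.

Lemma vosa_id_axioms (V : vosa s c) : @vosa_hom_axioms R s c V V id.
Proof. by split. Qed.

Lemma ovosa_id_axioms (V : ovosa s c) : @ovosa_hom_axioms R s c V V id.
Proof. by split. Qed.

Lemma vosa_comp_axioms (U V W : vosa s c) (g : vosa_hom V W)
    (f : vosa_hom U V) : vosa_hom_axioms (fun u => g (f u)).
Proof.
case: g f => [g [gD gZ gC gY g1 gt]] [f [fD fZ fC fY f1 ft]] /=; split.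
- by move=> u v; rewrite fD gD.
- by move=> a v; rewrite fZ gZ.
- by move=> k i v /fC /gC.
- by move=> u v k; rewrite fY gY.
- by rewrite f1 g1.
- by rewrite ft gt.
Qed.

Lemma ovosa_comp_axioms (U V W : ovosa s c) (g : ovosa_hom V W)
    (f : ovosa_hom U V) : ovosa_hom_axioms (fun u => g (f u)).
Proof.
case: g f => [g [gD gZ gC gY g1 gt]] [f [fD fZ fC fY f1 ft]] /=; split.
- by move=> u v; rewrite fD gD.
- by move=> a v; rewrite fZ gZ.
- by move=> k i v /fC /gC.
- by move=> u v b k; rewrite fY gY.
- by rewrite f1 g1.
- by rewrite ft gt.
Qed.

Definition SV : category.
Proof.
refine (@Category (vosa s c) (@vosa_hom R s c)
  (fun V => VosaHom (vosa_id_axioms V))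
  (fun U V W g f => VosaHom (vosa_comp_axioms g f)) _ _ _).
- by move=> *; exact: vosa_hom_eq.
- by move=> *; exact: vosa_hom_eq.
- by move=> *; exact: vosa_hom_eq.
Defined.

Definition SVphi : category.
Proof.
refine (@Category (ovosa s c) (@ovosa_hom R s c)
  (fun V => OVosaHom (ovosa_id_axioms V))
  (fun U V W g f => OVosaHom (ovosa_comp_axioms g f)) _ _ _).
- by move=> *; exact: ovosa_hom_eq.
- by move=> *; exact: ovosa_hom_eq.
- by move=> *; exact: ovosa_hom_eq.
Defined.

End Categories.

(* Main.v *)
Require Import Defs.
From mathcomp Require Import all_boot all_order all_algebra complex reals.
From mathcomp Require Import finmap monalg.
From mathcomp Require Import boolp classical_sets functions cardinality fsbigop.
From mathcomp Require Import zify.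

(** One functor sets the odd variable to zero.  For the other, the coefficient of
    phi^0 in the G(-1/2)-derivative property says that the phi-coefficient of
    Y(v, (x, phi)) is the phi-free part of Y(Gv, (x, phi)), where G = G(-1/2) is a
    mode of tau.  Hence Y(v, (x, phi)) = Y(v, x) + phi Y(Gv, x) is determined by
    its restriction (oY_extension), and the same formula (odd_extension) defines
    the functor that adjoins the odd variable.  Both functors keep the module, the
    vectors 1 and tau, and the maps underlying the morphisms, so they are inverse
    to each other on the nose once they are known to be well defined.

    The substance is that the extension satisfies the Jacobi identity with odd
    variables (odd_jacobi_extension).  Two facts about G enter.  The residue of the
    Jacobi identity for tau and u shows that G is an odd derivation,
    G Y(u, x) - (-1)^i Y(u, x) G = Y(Gu, x) for u of sign i (G_commutator); and the
    Neveu-Schwarz relations give G^2 = L(-1) (ns_G_square), so that Y(G^2 u, x) is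
    the derivative of Y(u, x).  As phi1 phi2 is even and squares to zero, each of the
    three delta functions with odd variables is the ordinary one, D, with x1 replaced
    by x1 - phi1 phi2, that is D - phi1 phi2 dD/dx1 (ojet_delta12, ojet_delta21,
    ojet_delta10).  Comparing the coefficients of 1, phi1, phi2 and phi1 phi2 then
    reduces the identity for (u, v) to the ordinary ones for (u, v), (Gu, v),
    (u, Gv), (Gu, Gv) and (G^2 u, v), together with the x1-derivative of the first.

    The operators L(n) do not depend on choices: the commutator formula for
    u = tau shows that the modes of G tau are the anticommutators of G with the
    G(n + 1/2), which are the 2 L(n) (oL_extension).

    Products of series are sums of finitely supported families, so each
    manipulation of coefficients needs a finiteness statement; these are the
    lemmas on conv_finite, which rest on truncation. *)

Set Implicit Arguments.
Unset Strict Implicit.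
Unset Printing Implicit Defensive.

Import Order.TTheory GRing.Theory Num.Theory.
Local Open Scope ring_scope.

(** * Signs and additive maps *)

Section Signs.
Variable M : zmodType.
Implicit Types x y : M.

Lemma sgnb0 b : sgnb b (0 : M) = 0.
Proof. by case: b; rewrite /= ?oppr0. Qed.

Lemma sgnbD b x y : sgnb b (x + y) = sgnb b x + sgnb b y.
Proof. by case: b; rewrite /= ?opprD. Qed.

Lemma sgnbB b x y : sgnb b (x - y) = sgnb b x - sgnb b y.
Proof. by case: b; rewrite /= ?opprD. Qed.

Lemma sgnb_ffun (I : finType) b (f : {ffun I -> M}) i : sgnb b f i = sgnb b (f i).
Proof. by case: b; rewrite /= ?ffunE. Qed.

End Signs.

Section AdditiveMaps.
Variables (U W : zmodType) (f : U -> W).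
Hypothesis fD : forall x y, f (x + y) = f x + f y.

Lemma addmap0 : f 0 = 0.
Proof. by apply: (addrI (f 0)); rewrite -fD !addr0. Qed.

Lemma addmapN x : f (- x) = - f x.
Proof. by apply: (addrI (f x)); rewrite -fD !subrr addmap0. Qed.

Lemma addmapMz x (n : int) : f (x *~ n) = f x *~ n.
Proof.
have fMn m : f (x *+ m) = f x *+ m.
  by elim: m => [|m IH]; rewrite ?mulr0n ?addmap0 // !mulrS fD IH.
by case: n => m; rewrite ?NegzE ?mulrNz ?addmapN -!pmulrn fMn.
Qed.

End AdditiveMaps.

(** * Scalars of the Grassmann algebra *)

Section GrassmannScalars.
Variables (K : comNzRingType) (s : option nat).
Implicit Types a : grassmann K s.

Lemma gscalarE (c : K) : c%:A = << c *g fset0 >> :> grassmann K s.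
Proof. by rewrite gscaleU mulr1. Qed.

(** Together with the left linearity of the product, this makes the scalars
    central, so that the action of C commutes with that of the Grassmann algebra. *)
Lemma gscaleAr (c : K) a : a * (c%:A) = c *: a.
Proof.
rewrite gscalarE -[a * _]/(gmul a _) gmulEl [in RHS](monalgE a) scaler_sumr.
apply: eq_bigr => S _.
by rewrite gmulUU merge_signX0 mul1r fsetU0 gscaleU mulrC.
Qed.

Lemma gscale_central (c : K) a : a * c%:A = c%:A * a.
Proof. by rewrite gscaleAr -scalerAl mul1r. Qed.

Lemma gsign_monomial (c : K) (S : {fset gen s}) : gsign (odd #|` S|) (<< c *g S >> : grassmann K s).
Proof. by move=> T; rewrite mcoeffU; case: (S =P T) => [->|_] //; rewrite mulr0n eqxx. Qed.

Lemma gsign_scalar (c : K) : gsign false (c%:A : grassmann K s).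
Proof. by rewrite gscalarE -[false]/(odd 0) -(@cardfs0 (gen s)); exact: gsign_monomial. Qed.

(** Every element is a sum of monomials, each of which has a sign, so additivity
    reduces a linearity statement to homogeneous scalars. *)
Lemma homogeneous_ind (P : grassmann K s -> Prop) :
    P 0 -> (forall a b, P a -> P b -> P (a + b)) ->
    (forall i a, gsign i a -> P a) -> forall a, P a.
Proof.
move=> P0 PD Ph a; rewrite [a]monalgE; elim/big_ind: _ => // S _.
exact: Ph (@gsign_monomial _ _).
Qed.

End GrassmannScalars.

(** * Convolution of formal series *)

Section BiadditiveMaps.
Variables (K : pzRingType) (V : zmodType) (op : K -> V -> V).
Hypothesis opDl : forall a b v, op (a + b) v = op a v + op b v.
Hypothesis opDr : forall a v w, op a (v + w) = op a v + op a w.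

Lemma op0l v : op 0 v = 0.
Proof. exact: (addmap0 (f := op^~ v) (fun a b => opDl a b v)). Qed.

Lemma op0r a : op a 0 = 0.
Proof. exact: addmap0 (opDr a). Qed.

Lemma opNl a v : op (- a) v = - op a v.
Proof. exact: (addmapN (f := op^~ v) (fun a b => opDl a b v)). Qed.

Lemma opNr a v : op a (- v) = - op a v.
Proof. exact: (addmapN (opDr a)). Qed.

Lemma op_mulzl a v (n : int) : op (a *~ n) v = op a v *~ n.
Proof. exact: (addmapMz (f := op^~ v) (fun a b => opDl a b v)). Qed.

Lemma op_mulzr a v (n : int) : op a (v *~ n) = op a v *~ n.
Proof. exact: (addmapMz (opDr a)). Qed.

End BiadditiveMaps.

(** The derivative with respect to x1. *)
Definition dx1 (M : zmodType) (f : expo -> M) : expo -> M :=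
  fun e => f (e + (0, 1, 0)) *~ (e.1.2 + 1).

(** Finitely supported sums are 0 when the support is infinite, so a product of
    series can be computed coefficientwise only where this holds. *)
Definition conv_finite (A B : zmodType) (f : expo -> A) (g : expo -> B) :=
  forall e, finite_set [set d | f d != 0 /\ g (e - d) != 0]%classic.

Section FiniteConvolutions.
Variables A B : zmodType.
Implicit Types (f : expo -> A) (g : expo -> B).

Lemma conv_finite_sub (A' B' : zmodType) f g (f' : expo -> A') (g' : expo -> B') :
  (forall d, f' d != 0 -> f d != 0) -> (forall d, g' d != 0 -> g d != 0) ->
  conv_finite f g -> conv_finite f' g'.
Proof.
move=> sf sg fin e; apply: sub_finite_set (fin e) => d [/sf ? /sg ?]; by split.
Qed.

Lemma conv_finite_dx1l f g : conv_finite f g -> conv_finite (dx1 f) g.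
Proof.
move=> fin e; have := fin (e + (0, 1, 0)).
move=> /(finite_image (fun d => d - (0, 1, 0))); apply: sub_finite_set => d [fd gd].
exists (d + (0, 1, 0)); last by rewrite addrK.
split; last by rewrite opprD addrACA subrr addr0.
by apply: contra_neq fd => fd; rewrite /dx1 fd mul0rz.
Qed.

Lemma conv_finite_fset f g e : conv_finite f g ->
  exists X : {fset expo}, forall d, f d != 0 -> g (e - d) != 0 -> d \in X.
Proof.
move=> /(_ e) fin; exists (fset_set [set d | f d != 0 /\ g (e - d) != 0]%classic).
by move=> d fd gd; rewrite in_fset_set //; apply: mem_set.
Qed.

End FiniteConvolutions.

Section ConvolutionSums.
Variables (K : pzRingType) (V : zmodType) (op : K -> V -> V).
Hypothesis opDl : forall a b v, op (a + b) v = op a v + op b v.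
Hypothesis opDr : forall a v w, op a (v + w) = op a v + op a w.
Implicit Types (D : expo -> K) (F : expo -> V).

Lemma sprod_fset D F e (X : {fset expo}) :
  (forall d, D d != 0 -> F (e - d) != 0 -> d \in X) ->
  sprod op D F e = \sum_(d <- X) op (D d) (F (e - d)).
Proof.
move=> sX; rewrite /sprod (@fsbigTE _ _ _ _ X) // => d dX.
have [->|Dd] := eqVneq (D d) 0; first by rewrite (op0l opDl).
have [->|Fd] := eqVneq (F (e - d)) 0; first by rewrite (op0r opDr).
by rewrite (sX d) in dX.
Qed.

(** Used to extract residues, where the Jacobi identity has one summand per term. *)
Lemma sprod1 D F e d0 :
  (forall d, D d != 0 -> F (e - d) != 0 -> d = d0) ->
  sprod op D F e = op (D d0) (F (e - d0)).
Proof.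
move=> h; rewrite (@sprod_fset _ _ _ [fset d0]%fset) ?big_seq_fset1 //.
by move=> d Dd Fd; rewrite (h d) // inE.
Qed.

Lemma sprodDr D F F' e : conv_finite D F -> conv_finite D F' ->
  sprod op D (fun d => F d + F' d) e = sprod op D F e + sprod op D F' e.
Proof.
move=> /conv_finite_fset-/(_ e)[X EX] /conv_finite_fset-/(_ e)[X' EX'].
have sub d : D d != 0 -> F (e - d) != 0 -> d \in (X `|` X')%fset.
  by move=> Dd Fd; rewrite inE; apply/orP; left; exact: EX.
have sub' d : D d != 0 -> F' (e - d) != 0 -> d \in (X `|` X')%fset.
  by move=> Dd Fd; rewrite inE; apply/orP; right; exact: EX'.
rewrite !(@sprod_fset _ _ _ (X `|` X')%fset) // -?big_split /=.
  by apply: eq_bigr => d _; rewrite opDr.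
move=> d Dd; have [->|Fd _] := eqVneq (F (e - d)) 0; last exact: sub.
by rewrite add0r => Fd; exact: sub'.
Qed.

(** The Leibniz rule: the factor e1 + 1 splits as d1 + (e1 + 1 - d1) in each
    summand, and the part with d1 is reindexed by a shift in x1. *)
Lemma sprod_dx1 D F : conv_finite D F ->
  dx1 (sprod op D F) =1 fun e => sprod op (dx1 D) F e + sprod op D (dx1 F) e.
Proof.
move=> fin e; rewrite {1}/dx1.
have [X sub] := conv_finite_fset (e + (0, 1, 0)) fin.
rewrite (sprod_fset sub).
have -> : sprod op (dx1 D) F e =
    \sum_(d <- X) op (D d *~ d.1.2) (F (e + (0, 1, 0) - d)).
  rewrite /sprod (reindex_fsbigT (fun d : expo => d - (0, 1, 0))); last first.
    by exists (fun d => d + (0, 1, 0)) => // d; rewrite addrK.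
  rewrite (@fsbigTE _ _ _ _ X) /= => [|d dX].
    by apply: eq_bigr => d _; rewrite /dx1 /= !subrK opprD opprK addrA addrAC.
  rewrite /dx1 /= !subrK opprD opprK addrA addrAC.
  have [->|Dd] := eqVneq (D d) 0; first by rewrite mul0rz (op0l opDl).
  have [->|Fd] := eqVneq (F (e + (0, 1, 0) - d)) 0; first by rewrite (op0r opDr).
  by rewrite (sub d) in dX.
have -> : sprod op D (dx1 F) e =
    \sum_(d <- X) op (D d) (F (e + (0, 1, 0) - d) *~ (e.1.2 - d.1.2 + 1)).
  rewrite (@sprod_fset _ _ _ X) => [|d Dd].
    by apply: eq_bigr => d _; rewrite /dx1 addrAC.
  by rewrite /dx1 addrAC => Fd; apply: sub => //; apply: contra_neq Fd => ->; rewrite mul0rz.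
rewrite -big_split /= mulrz_suml; apply: eq_bigr => d _.
rewrite (op_mulzl opDl) (op_mulzr opDr) -mulrzDr; congr (_ *~ _).
by rewrite addrA addrCA subrr addr0.
Qed.

End ConvolutionSums.

(** * Delta functions shifted by an even nilpotent *)

Section Binomials.
Variable K : numFieldType.
Implicit Types (n a b : int).

Lemma falling_prodS n k :
  \prod_(j < k.+1) (n%:~R - j%:R) = n%:~R * \prod_(j < k) ((n - 1)%:~R - j%:R) :> K.
Proof.
rewrite big_ord_recl subr0; congr (_ * _); apply: eq_bigr => j _.
by rewrite lift0 intrB -natr1 opprD addrA addrAC.
Qed.

Lemma gbinom_absorb n k :
  gbinom K n k.+1 * k.+1%:R = n%:~R * gbinom K (n - 1) k.
Proof.
rewrite /gbinom falling_prodS factS natrM -!mulrA; congr (_ * (_ * _)).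
by rewrite invfM mulrAC mulVf ?mul1r // pnatr_eq0.
Qed.

Lemma gbinom_absorbl n k :
  gbinom K n k * (n - k%:Z)%:~R = n%:~R * gbinom K (n - 1) k.
Proof.
rewrite /gbinom mulrA -falling_prodS big_ord_recr /= mulrAC; congr (_ * _ * _).
by rewrite intrB.
Qed.

(** The derivatives of (x - y)^n in x, and then in y. *)
Lemma bpow_dl n a b : bpow K n (a + 1) b *~ (a + 1) = n%:~R * bpow K (n - 1) a b.
Proof.
rewrite /bpow addrAC -subr_eq opprK; case: ifP => [/andP[]|]; last first.
  by rewrite mul0rz mulr0.
case: b => // k _ /eqP En.
have -> : a + 1 = n - k%:Z by lia.
by rewrite -mulrzr -mulrA gbinom_absorbl mulrCA.
Qed.

Lemma bpow_dr n a b : bpow K n a (b + 1) *~ (b + 1) = - (n%:~R * bpow K (n - 1) a b).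
Proof.
rewrite /bpow addrA -subr_eq opprK.
case: b => [k|[|k]]; last 2 first.
- by rewrite mulr0z mulr0 oppr0.
- by rewrite mul0rz mulr0 oppr0.
case: ifP => [_|]; last by rewrite mul0rz mulr0 oppr0.
rewrite -[k%:Z + 1]/(Posz (k + 1)) addn1 /= -pmulrn -mulr_natr -mulrA gbinom_absorb.
by rewrite exprS mulN1r mulNr mulrCA.
Qed.

End Binomials.

Section Jets.
Variable K : numFieldType.

(** The series D with x1 replaced by x1 - phi1 phi2: as phi1 phi2 squares to
    zero, the Taylor expansion stops after the first derivative. *)
Definition ojet (D : expo -> K) : expo -> odd2 K :=
  fun d => oconst (D d) - phi1 (phi2 (oconst (dx1 D d))).

Lemma ojetE D d b : ojet D d b =
  if b.1 && b.2 then - dx1 D d else if b == (false, false) then D d else 0.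
Proof. by case: b => [[] []]; rewrite !ffunE /= ?subr0 // sub0r. Qed.

Lemma opowE (eps : K) n a b p : opow eps n a b p =
  if p.1 && p.2 then eps * n%:~R * bpow K (n - 1) a b
  else if p == (false, false) then bpow K n a b else 0.
Proof. by case: p => [[] []]; rewrite !ffunE /= ?addr0 // add0r. Qed.

Lemma ojet_delta12 : x0inv (@odelta12_0 K) = ojet (x0inv (@delta12_0 K)).
Proof.
apply/funext => -[[d0 d1] d2]; apply/ffunP => b; rewrite ojetE opowE /=.
rewrite /dx1 /xshift /delta12_0 /= !subr0 bpow_dl; case: ifP => // _.
by rewrite mulN1r mulNr.
Qed.

(** Only the difference x2 - x1 occurs here, so adding phi1 phi2 to it is again
    replacing x1 by x1 - phi1 phi2. *)
Lemma ojet_delta21 : x0inv (@odelta21_0 K) = ojet (x0inv (@delta21_0 K)).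
Proof.
apply/funext => -[[d0 d1] d2]; apply/ffunP => b; rewrite ojetE ffunE opowE /=.
rewrite /dx1 /xshift /delta21_0 /= !subr0 ?addr0 -mulrzAr bpow_dr mul1r.
case: (b.1 && b.2); first by rewrite mulrN [RHS]opprK.
by case: (b == _); rewrite ?mulr0.
Qed.

Lemma ojet_delta10 : x2inv (@odelta10_2 K) = ojet (x2inv (@delta10_2 K)).
Proof.
apply/funext => -[[d0 d1] d2]; apply/ffunP => b; rewrite ojetE opowE /=.
rewrite /dx1 /xshift /delta10_2 /= !subr0 ?addr0 bpow_dl; case: ifP => // _.
by rewrite mulN1r mulNr.
Qed.

Lemma bpow_neq0 n a b : bpow K n a b != 0 -> 0 <= b /\ a + b = n.
Proof. by rewrite /bpow; case: ifP => [/andP[? /eqP ?]|]; rewrite ?eqxx. Qed.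

Lemma bpow0 a b : bpow K 0 a b = ((a == 0) && (b == 0))%:R.
Proof.
rewrite /bpow; case: b => [[|k]|k] /=; last by rewrite andbF.
  by rewrite addr0 andbT /gbinom big_ord0 fact0 divr1 mulr1; case: eqP.
rewrite /gbinom big_ord_recl !mulr0z subr0 !mul0r mulr0.
by rewrite andbF; case: ifP.
Qed.

End Jets.

Lemma finite_int_box (B : nat) :
  finite_set [set d : expo | [/\ `|d.1.1| <= B%:Z, `|d.1.2| <= B%:Z & `|d.2| <= B%:Z]]%classic.
Proof.
pose i (k : 'I_(B + B).+1) : int := (k : nat)%:Z - B%:Z.
pose f (k : 'I_(B + B).+1 * 'I_(B + B).+1 * 'I_(B + B).+1) := (i k.1.1, i k.1.2, i k.2).
have /finite_image-/(_ _ f) : finite_set [set: ('I_(B + B).+1 * 'I_(B + B).+1 * 'I_(B + B).+1)%type]%classic by exact: finite_finset.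
apply: sub_finite_set => -[[d0 d1] d2] /= [h0 h1 h2].
have iK (z : int) : `|z| <= B%:Z -> exists k, i k = z.
  move=> zB; exists (inord (absz (z + B%:Z))); rewrite /i inordK; lia.
have [[k0 <-] [k1 <-]] := (iK _ h0, iK _ h1); have [k2 <-] := iK _ h2.
by exists (k0, k1, k2).
Qed.

Section Supports.
Variables (K : numFieldType) (M : zmodType) (F : expo -> M).

(** Homogeneity leaves two free exponents in a delta function.  One is fixed by
    the exponents of the vector-valued series; the other is bounded below by the
    direction of expansion and above by truncation. *)
Lemma conv_finite_delta12 N : (forall e, F e != 0 -> e.1.1 = 0 /\ N <= e.2) ->
  conv_finite (x0inv (@delta12_0 K)) F.
Proof.
move=> sF [[e0 e1] e2].
apply: sub_finite_set (finite_int_box (`|e0|%N + `|e2|%N + `|N|%N).*2.+1) => -[[d0 d1] d2] /=.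
rewrite /xshift /delta12_0 /= => -[/bpow_neq0[? ?] /sF[/= ? ?]]; split; lia.
Qed.

Lemma conv_finite_delta21 N : (forall e, F e != 0 -> e.1.1 = 0 /\ N <= e.1.2) ->
  conv_finite (x0inv (@delta21_0 K)) F.
Proof.
move=> sF [[e0 e1] e2].
apply: sub_finite_set (finite_int_box (`|e0|%N + `|e1|%N + `|N|%N).*2.+1) => -[[d0 d1] d2] /=.
rewrite /xshift /delta21_0 /= mulf_eq0 negb_or => -[/andP[_ /bpow_neq0[? ?]] /sF[/= ? ?]]; split; lia.
Qed.

Lemma conv_finite_delta10 N : (forall e, F e != 0 -> e.1.2 = 0 /\ N <= e.1.1) ->
  conv_finite (x2inv (@delta10_2 K)) F.
Proof.
move=> sF [[e0 e1] e2].
apply: sub_finite_set (finite_int_box (`|e0|%N + `|e1|%N + `|N|%N).*2.+1) => -[[d0 d1] d2] /=.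
rewrite /xshift /delta10_2 /= => -[/bpow_neq0[? ?] /sF[/= ? ?]]; split; lia.
Qed.

End Supports.

(** * The coefficients of the odd Jacobi identity *)

Lemma sum_bool_pair (M : zmodType) (F : bool * bool -> M) :
  \sum_b F b = F (true, true) + F (true, false) + (F (false, true) + F (false, false)).
Proof.
rewrite (eq_bigr (fun b => F (b.1, b.2))); last by case.
by rewrite -(pair_bigA _ (fun p q => F (p, q))) /= !big_bool.
Qed.

Section OddProducts.
Variables (R : realType) (s : option nat) (V : gmodule R s).
Local Notation C := R[i].
Implicit Types (u v w : V) (e : expo).

Lemma cscaleDl (a b : C) v : cscale (a + b) v = cscale a v + cscale b v.
Proof. by rewrite /cscale scalerDl scalerDl. Qed.

Lemma cscaleDr (a : C) u v : cscale a (u + v) = cscale a u + cscale a v.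
Proof. exact: scalerDr. Qed.

Lemma cscale1 v : cscale 1 v = v.
Proof. by rewrite /cscale !scale1r. Qed.

Lemma cscaleA (a b : C) v : cscale a (cscale b v) = cscale (a * b) v.
Proof.
rewrite /cscale [LHS]scalerA; congr (_ *: v).
by rewrite gscaleAr [LHS]scalerA mulrC.
Qed.

Lemma cscale_int (n : int) v : cscale n%:~R v = v *~ n.
Proof. by rewrite -{1}[n%:~R]mul1r mulrzr (op_mulzl cscaleDl) cscale1. Qed.

Lemma sprod_sgnb b (D : expo -> C) (F : expo -> V) e :
  conv_finite D F ->
  sprod (@cscale R s V) D (fun d => sgnb b (F d)) e = sgnb b (sprod (@cscale R s V) D F e).
Proof.
move=> /conv_finite_fset-/(_ e)[X sX]; case: b => //=.
rewrite !(sprod_fset cscaleDl cscaleDr (X := X)) // => [|d Dd].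
  by rewrite -sumrN; apply: eq_bigr => d _; rewrite (opNr cscaleDr).
by rewrite oppr_eq0 => /(sX _ Dd).
Qed.

Lemma oscale_ojet (D : expo -> C) d (g : odd2 V) b :
  oscale (ojet D d) g b = cscale (D d) (g b)
    - (if b.1 && b.2 then cscale (dx1 D d) (g (false, false)) else 0).
Proof.
rewrite /oscale sum_ffunE.
rewrite sum_bool_pair !ojetE /= !scale0r !ffunE !addr0 !add0r.
case: b => [[] []] /=; last 3 first; try by rewrite [X in X + _]scaler0 add0r subr0.
by rewrite addrC -(opNl cscaleDl).
Qed.

(** The correction term of the jet contains phi1 phi2, so it meets only the part
    of g that is free of odd variables. *)
Lemma sprod_ojet (D : expo -> C) (g : expo -> odd2 V) e b : conv_finite D g ->
  sprod (@oscale R s V) (ojet D) g e b =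
  sprod (@cscale R s V) D (fun d => g d b) e
  - (if b.1 && b.2 then sprod (@cscale R s V) (dx1 D) (fun d => g d (false, false)) e
     else 0).
Proof.
move=> fin.
have [X sX] := conv_finite_fset e fin.
have [X' sX'] := conv_finite_fset e (conv_finite_dx1l fin).
have gb d b' : g d b' != 0 -> g d != 0.
  by apply: contra_neq => ->; rewrite ffunE.
rewrite [in LHS]/sprod (@fsbigTE _ _ _ _ (X `|` X')%fset) => [|d].
  rewrite sum_ffunE /sprod; under eq_bigr do rewrite oscale_ojet.
  rewrite sumrB; congr (_ - _).
    rewrite (@fsbigTE _ _ _ _ (X `|` X')%fset) // => d; rewrite inE => /norP[dX _].
    have [->|Dd] := eqVneq (D d) 0; first by rewrite (op0l cscaleDl).
    have [->|Fd] := eqVneq (g (e - d) b) 0; first by rewrite (op0r cscaleDr).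
    by rewrite (sX d Dd (gb _ _ Fd)) in dX.
  case: (b.1 && b.2); last by rewrite big1.
  rewrite (@fsbigTE _ _ _ _ (X `|` X')%fset) // => d; rewrite inE => /norP[_ dX].
  have [->|Dd] := eqVneq (dx1 D d) 0; first by rewrite (op0l cscaleDl).
  have [->|Fd] := eqVneq (g (e - d) (false, false)) 0; first by rewrite (op0r cscaleDr).
  by rewrite (sX' d Dd (gb _ _ Fd)) in dX.
rewrite inE => /norP[dX dX']; apply/ffunP => b'; rewrite oscale_ojet !ffunE.
have [->|gd] := eqVneq (g (e - d)) 0.
  by rewrite !ffunE !(op0r cscaleDr) if_same subr0.
have [D0|Dd] := eqVneq (D d) 0; last by rewrite (sX d Dd gd) in dX.
have [D1|Dd] := eqVneq (dx1 D d) 0; last by rewrite (sX' d Dd gd) in dX'.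
by rewrite D0 D1 !(op0l cscaleDl) if_same subr0.
Qed.

(** Y(u, x) + phi Y(Gu, x): the shape that the G(-1/2)-derivative property
    imposes on a vertex operator with odd variables when G is G(-1/2). *)
Definition odd_extension (G : V -> V) (Y : V -> V -> int -> V) :
    V -> V -> bool -> int -> V :=
  fun u v b k => Y (if b then G u else u) v k.

Variables (G : V -> V) (Y : V -> V -> int -> V).
Local Notation sgn_ i := (sign_space (@gcomp R s V) i).
Hypothesis YDl : forall u u' v k, Y (u + u') v k = Y u v k + Y u' v k.
Hypothesis YDr : forall i u v v' k, sgn_ i u -> Y u (v + v') k = Y u v k + Y u v' k.
Hypothesis trunc : forall u v, exists N : int, forall k, k < N -> Y u v k = 0.
Hypothesis Gsign : forall i u, sgn_ i u -> sgn_ (~~ i) (G u).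

Let Y' := odd_extension G Y.
Local Notation Gif b u := (if b then G u else u).

Lemma Gif_sign i b u : sgn_ i u -> sgn_ (b (+) i) (Gif b u).
Proof. by case: b => //= /Gsign. Qed.

Lemma Y0l w k : Y 0 w k = 0.
Proof. exact: (addmap0 (f := fun u => Y u w k) (fun u u' => YDl u u' w k)). Qed.

Lemma YNl u w k : Y (- u) w k = - Y u w k.
Proof. exact: (addmapN (f := fun u => Y u w k) (fun u u' => YDl u u' w k)). Qed.

Lemma Y0r i u k : sgn_ i u -> Y u 0 k = 0.
Proof. by move=> su; apply: (addmap0 (f := fun v => Y u v k)) => v v'; exact: YDr su. Qed.

(** Y(u, (x1, phi1)) Y(v, (x2, phi2)) expands as
      A B + phi1 A' B + (-1)^i phi2 A B' + (-1)^(i + 1) phi1 phi2 A' B'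
    with A = Y(u, x1), A' = Y(Gu, x1) and likewise B, B' for v; the signs come
    from moving phi2 to the left past A or A'. *)
Lemma oY1Y2E i j u v w e b : sgn_ i u -> sgn_ j v ->
  oY1Y2 Y' i j u v w e b =
  sgnb (b.2 && (b.1 (+) i)) (Y1Y2 Y (Gif b.1 u) (Gif b.2 v) w e).
Proof.
move=> su sv; rewrite /oY1Y2 /Y1Y2; case: ifP => _; last by rewrite ffunE sgnb0.
have u0 k := Y0r k su; have u1 k := Y0r k (Gsign su).
have v0 k := Y0r k sv; have v1 k := Y0r k (Gsign sv).
rewrite /Yop /oext /phi1 /phi2 /oconst /Y' /odd_extension.
by case: b => [[] []]; do ![rewrite !ffunE /=]; case: i su => su; case: j sv => sv;
  rewrite /= ?(v0, v1, u0, u1, oppr0, addr0, add0r, opprK).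
Qed.

(** Here it is phi1 that moves to the left, past B or past phi2 B'; both have the
    sign j, as phi2 and B' together are as odd as B. *)
Lemma oY2Y1E i j u v w e b : sgn_ i u -> sgn_ j v ->
  oY2Y1 Y' i j u v w e b =
  sgnb (b.1 && j) (Y2Y1 Y (Gif b.1 u) (Gif b.2 v) w e).
Proof.
move=> su sv; rewrite /oY2Y1 /Y2Y1; case: ifP => _; last by rewrite ffunE sgnb0.
have u0 k := Y0r k su; have u1 k := Y0r k (Gsign su).
have v0 k := Y0r k sv; have v1 k := Y0r k (Gsign sv).
rewrite /Yop /oext /phi1 /phi2 /oconst /Y' /odd_extension.
by case: b => [[] []]; do ![rewrite !ffunE /=]; case: i su => su; case: j sv => sv;
  rewrite /= ?(v0, v1, u0, u1, oppr0, addr0, add0r, opprK).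
Qed.

(** The argument phi1 - phi2 contributes - Y(Y(Gu, x0)v, x2) to the coefficient
    of phi2; its product with the outer phi2 leaves phi1 phi2 only. *)
Lemma oYYE u v w e b : oYY Y' u v w e b =
  if e.1.2 == 0 then
    let uv := Y (Gif b.1 u) v e.1.1 in
    if b.2 then Y (G uv) w e.2 - (if b.1 then 0 else Y (Y (G u) v e.1.1) w e.2)
    else Y uv w e.2
  else 0.
Proof.
rewrite /oYY; case: ifP => _; last by rewrite ffunE.
rewrite /Ylin sum_ffunE.
rewrite sum_bool_pair /= /Ydiff /phi1 /phi2 /oconst /Y' /odd_extension.
case: b => [[] []]; do ![rewrite !ffunE /=];
  rewrite ?(addr0, add0r, sub0r, subr0, oppr0, Y0l, YNl) // addrC //.
Qed.

Lemma Y1Y2_support i u v w : sgn_ i u ->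
  exists N : int, forall e, Y1Y2 Y u v w e != 0 -> e.1.1 = 0 /\ N <= e.2.
Proof.
move=> su; have [N hN] := trunc v w; exists N => e; rewrite /Y1Y2.
case: (e.1.1 =P 0) => [-> |_]; last by rewrite eqxx.
by case: leP => // lt; rewrite hN // (Y0r _ su) eqxx.
Qed.

Lemma Y2Y1_support j u v w : sgn_ j v ->
  exists N : int, forall e, Y2Y1 Y u v w e != 0 -> e.1.1 = 0 /\ N <= e.1.2.
Proof.
move=> sv; have [N hN] := trunc u w; exists N => e; rewrite /Y2Y1.
case: (e.1.1 =P 0) => [-> |_]; last by rewrite eqxx.
by case: leP => // lt; rewrite hN // (Y0r _ sv) eqxx.
Qed.

Lemma YY_support u v w :
  exists N : int, forall e, YY Y u v w e != 0 -> e.1.2 = 0 /\ N <= e.1.1.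
Proof.
have [N hN] := trunc u v; exists N => e; rewrite /YY.
case: (e.1.2 =P 0) => [-> |_]; last by rewrite eqxx.
by case: leP => // lt; rewrite hN // Y0l eqxx.
Qed.

Lemma ffun_neq0P (f : odd2 V) : reflect (exists b, f b != 0) (f != 0).
Proof.
apply: (iffP idP) => [|[b]]; last by apply: contra_neq => ->; rewrite ffunE.
apply: contra_neqP => f0; apply/ffunP => b; rewrite ffunE.
by apply/eqP/negPn/negP => fb; apply: f0; exists b.
Qed.

Lemma sgnb_neq0 b v : (sgnb b v != 0) = (v != 0).
Proof. by case: b => //=; rewrite oppr_eq0. Qed.

Local Notation D12 := (x0inv (@delta12_0 C)).
Local Notation D21 := (x0inv (@delta21_0 C)).
Local Notation D10 := (x2inv (@delta10_2 C)).

Lemma conv_finite_Y1Y2 i u v w : sgn_ i u -> conv_finite D12 (Y1Y2 Y u v w).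
Proof. by move=> /(Y1Y2_support v w)[N]; exact: conv_finite_delta12. Qed.

Lemma conv_finite_Y2Y1 j u v w : sgn_ j v -> conv_finite D21 (Y2Y1 Y u v w).
Proof. by move=> /(Y2Y1_support u w)[N]; exact: conv_finite_delta21. Qed.

Lemma conv_finite_YY u v w : conv_finite D10 (YY Y u v w).
Proof. by have [N] := YY_support u v w; exact: conv_finite_delta10. Qed.

Lemma conv_finite_oY1Y2 i j u v w : sgn_ i u -> sgn_ j v ->
  conv_finite D12 (oY1Y2 Y' i j u v w).
Proof.
move=> su sv; have [N hN] := trunc v w; have [N' hN'] := trunc (G v) w.
apply: (@conv_finite_delta12 _ _ _ (Num.min N N')) => e.
move=> /ffun_neq0P[b]; rewrite oY1Y2E // sgnb_neq0 /Y1Y2.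
case: (e.1.1 =P 0) => [-> |_]; last by rewrite eqxx.
case: leP => //; rewrite lt_min => /andP[lt lt'].
have -> : Y (Gif b.2 v) w e.2 = 0 by case: b.2; rewrite ?hN ?hN'.
by rewrite (Y0r _ (Gif_sign b.1 su)) eqxx.
Qed.

Lemma conv_finite_oY2Y1 i j u v w : sgn_ i u -> sgn_ j v ->
  conv_finite D21 (oY2Y1 Y' i j u v w).
Proof.
move=> su sv; have [N hN] := trunc u w; have [N' hN'] := trunc (G u) w.
apply: (@conv_finite_delta21 _ _ _ (Num.min N N')) => e.
move=> /ffun_neq0P[b]; rewrite oY2Y1E // sgnb_neq0 /Y2Y1.
case: (e.1.1 =P 0) => [-> |_]; last by rewrite eqxx.
case: leP => //; rewrite lt_min => /andP[lt lt'].
have -> : Y (Gif b.1 u) w e.1.2 = 0 by case: b.1; rewrite ?hN ?hN'.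
by rewrite (Y0r _ (Gif_sign b.2 sv)) eqxx.
Qed.

Lemma conv_finite_oYY u v w : G 0 = 0 -> conv_finite D10 (oYY Y' u v w).
Proof.
move=> G0; have [N hN] := trunc u v; have [N' hN'] := trunc (G u) v.
apply: (@conv_finite_delta10 _ _ _ (Num.min N N')) => e.
move=> /ffun_neq0P[b]; rewrite oYYE /=.
case: (e.1.2 =P 0) => [-> |_]; last by rewrite eqxx.
case: leP => //; rewrite lt_min => /andP[lt lt'].
have -> : Y (Gif b.1 u) v e.1.1 = 0 by case: b.1; rewrite ?hN ?hN'.
by rewrite hN' // G0 !Y0l if_same subr0 if_same eqxx.
Qed.

Local Notation conv := (sprod (@cscale R s V)).
Local Notation oconv := (sprod (@oscale R s V)).

Lemma oconv_Y1Y2 i j u v w e b : sgn_ i u -> sgn_ j v ->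
  oconv (x0inv (@odelta12_0 C)) (oY1Y2 Y' i j u v w) e b =
  sgnb (b.2 && (b.1 (+) i)) (conv D12 (Y1Y2 Y (Gif b.1 u) (Gif b.2 v) w) e)
  - (if b.1 && b.2 then conv (dx1 D12) (Y1Y2 Y u v w) e else 0).
Proof.
move=> su sv; rewrite ojet_delta12 sprod_ojet; last exact: conv_finite_oY1Y2.
have E b' := funext (fun d => oY1Y2E w d b' su sv).
rewrite !E sprod_sgnb //; exact: conv_finite_Y1Y2 (Gif_sign b.1 su).
Qed.

Lemma oconv_Y2Y1 i j u v w e b : sgn_ i u -> sgn_ j v ->
  oconv (x0inv (@odelta21_0 C)) (oY2Y1 Y' i j u v w) e b =
  sgnb (b.1 && j) (conv D21 (Y2Y1 Y (Gif b.1 u) (Gif b.2 v) w) e)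
  - (if b.1 && b.2 then conv (dx1 D21) (Y2Y1 Y u v w) e else 0).
Proof.
move=> su sv; rewrite ojet_delta21 sprod_ojet; last exact: conv_finite_oY2Y1.
have E b' := funext (fun d => oY2Y1E w d b' su sv).
rewrite !E sprod_sgnb //; exact: conv_finite_Y2Y1 (Gif_sign b.2 sv).
Qed.

Lemma oYY_even u v w : (fun d => oYY Y' u v w d (false, false)) = YY Y u v w.
Proof. by apply/funext => d; rewrite oYYE. Qed.

Lemma oconv_YY u v w e b : G 0 = 0 ->
  oconv (x2inv (@odelta10_2 C)) (oYY Y' u v w) e b =
  conv D10 (fun d => oYY Y' u v w d b) e
  - (if b.1 && b.2 then conv (dx1 D10) (YY Y u v w) e else 0).
Proof.
move=> G0; rewrite ojet_delta10 sprod_ojet; last exact: conv_finite_oYY.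
by rewrite oYY_even.
Qed.

Lemma dx1_Y1Y2 T u v w : (forall w k, Y u w (k + 1) *~ (k + 1) = Y (T u) w k) ->
  dx1 (Y1Y2 Y u v w) = Y1Y2 Y (T u) v w.
Proof.
move=> uT; apply/funext => e; rewrite /dx1 /Y1Y2 /= !addr0.
by case: ifP => _; rewrite ?uT ?mul0rz.
Qed.

Lemma dx1_Y2Y1 j T u v w : sgn_ j v ->
  (forall w k, Y u w (k + 1) *~ (k + 1) = Y (T u) w k) ->
  dx1 (Y2Y1 Y u v w) = Y2Y1 Y (T u) v w.
Proof.
move=> sv uT; apply/funext => e; rewrite /dx1 /Y2Y1 /= !addr0.
case: ifP => _; last by rewrite mul0rz.
pose f v' := Y v v' e.2.
have fD v1 v2 : f (v1 + v2) = f v1 + f v2 by exact: YDr sv.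
by rewrite -uT; exact/esym/(addmapMz fD).
Qed.

Lemma dx1_YY u v w : dx1 (YY Y u v w) = fun=> 0.
Proof.
apply/funext => e; rewrite /dx1 /YY /=.
by case: eqP => [->|_]; rewrite ?mulr0z ?mul0rz.
Qed.

Definition jacobi i j u v w := forall e,
  conv D12 (Y1Y2 Y u v w) e - sgnb (i && j) (conv D21 (Y2Y1 Y u v w) e)
  = conv D10 (YY Y u v w) e.

Definition odd_jacobi i j u v w := forall e,
  oconv (x0inv (odelta12_0 C)) (oY1Y2 Y' i j u v w) e
  - sgnb (i && j) (oconv (x0inv (odelta21_0 C)) (oY2Y1 Y' i j u v w) e)
  = oconv (x2inv (odelta10_2 C)) (oYY Y' u v w) e.

(** Setting phi1 = phi2 = 0. *)
Lemma jacobi_of_odd i j u v w : sgn_ i u -> sgn_ j v -> G 0 = 0 ->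
  odd_jacobi i j u v w -> jacobi i j u v w.
Proof.
move=> su sv G0 + e => /(_ e)/ffunP/(_ (false, false)).
rewrite [LHS]ffunE [X in _ + X]ffunE sgnb_ffun oconv_Y1Y2 // oconv_Y2Y1 // oconv_YY //= !subr0.
by move=> ->; rewrite oYY_even.
Qed.

Hypothesis YJ : forall i j u v w, sgn_ i u -> sgn_ j v -> jacobi i j u v w.
Hypothesis GD : forall u v, G (u + v) = G u + G v.
(* For G = G(-1/2), Gder is a residue of the Jacobi identity, and GG combines the
   Neveu-Schwarz relation G(-1/2)^2 = L(-1) with the L(-1)-derivative property. *)
Hypothesis Gder : forall i u v k, sgn_ i u ->
  G (Y u v k) = Y (G u) v k + sgnb i (Y u (G v) k).
Hypothesis GG : forall u v k, Y u v (k + 1) *~ (k + 1) = Y (G (G u)) v k.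

(** The x1-derivative of the Jacobi identity for (u, v), minus the Jacobi identity
    for (G^2 u, v).  By the Leibniz rule and GG, the latter is the part of the
    former in which the vertex operators are differentiated; Y(Y(u, x0)v, x2) does
    not involve x1, so nothing cancels the term with G^2 u on the right. *)
Lemma conv_dx1_jacobi i j u v w e : sgn_ i u -> sgn_ j v ->
  conv (dx1 D12) (Y1Y2 Y u v w) e - sgnb (i && j) (conv (dx1 D21) (Y2Y1 Y u v w) e)
  = conv (dx1 D10) (YY Y u v w) e - conv D10 (YY Y (G (G u)) v w) e.
Proof.
move=> su sv; have suGG : sgn_ i (G (G u)) by rewrite -(negbK i); do 2 apply: Gsign.
have dx12 := sprod_dx1 cscaleDl cscaleDr (conv_finite_Y1Y2 v w su) e.
have dx21 := sprod_dx1 cscaleDl cscaleDr (conv_finite_Y2Y1 u w sv) e.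
have dx10 := sprod_dx1 cscaleDl cscaleDr (@conv_finite_YY u v w) e.
rewrite (dx1_Y1Y2 _ _ (T := G \o G)) // in dx12.
rewrite (dx1_Y2Y1 _ sv (T := G \o G)) // in dx21.
rewrite dx1_YY [X in _ + X](_ : _ = 0) ?addr0 in dx10; last first.
  by rewrite /sprod fsbig1 // => d _; rewrite (op0r cscaleDr).
rewrite -dx10 -(YJ w suGG sv e).
have -> : dx1 (conv D10 (YY Y u v w)) e =
    dx1 (conv D12 (Y1Y2 Y u v w)) e - sgnb (i && j) (dx1 (conv D21 (Y2Y1 Y u v w)) e).
  by rewrite /dx1 -(funext (YJ w su sv)) mulrzBl; case: (i && j) => //=; rewrite mulNrz.
by rewrite dx12 dx21 sgnbD (opprD (sgnb _ _)) addrACA addrK.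
Qed.

(** The coefficients of 1 and phi1 are the Jacobi identities for (u, v) and (Gu, v).
    That of phi2 is the one for (u, Gv) up to the sign (-1)^i, by the derivation
    property Gder.  That of phi1 phi2 is the one for (Gu, Gv), up to the sign
    (-1)^(i + 1), combined with the terms that the jets add: these are accounted
    for by the x1-derivative of the identity for (u, v). *)
Lemma odd_jacobi_extension i j u v w : sgn_ i u -> sgn_ j v -> odd_jacobi i j u v w.
Proof.
move=> su sv e; apply/ffunP => b.
rewrite [LHS]ffunE [X in _ + X]ffunE sgnb_ffun.
have [sGu sGv] := (Gsign su, Gsign sv).
have G0 := addmap0 GD.
rewrite oconv_Y1Y2 // oconv_Y2Y1 // oconv_YY //.
have JGu := YJ w sGu sv e.
have JGv := YJ w su sGv e.
have JGG := YJ w sGu sGv e.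
case: b => [[] []] /=; rewrite ?oYY_even ?subr0.
- have -> : (fun d => oYY Y' u v w d (true, true)) =
      (fun d => YY Y (G (G u)) v w d + sgnb (~~ i) (YY Y (G u) (G v) w d)).
    apply/funext => d; rewrite oYYE /YY /=; case: ifP; rewrite ?sgnb0 ?addr0 //.
    by rewrite subr0 (Gder _ _ sGu) YDl; case: (i) => //=; rewrite YNl.
  rewrite (sprodDr cscaleDl cscaleDr (D := D10)); last 2 first.
  + exact: conv_finite_YY.
  + apply: conv_finite_sub (@conv_finite_YY (G u) (G v) w) => // d.
    by rewrite sgnb_neq0.
  rewrite sprod_sgnb; last exact: conv_finite_YY.
  have -> : sgnb (~~ i) (conv D10 (YY Y (G u) (G v) w) e) =
      sgnb (~~ i) (conv D12 (Y1Y2 Y (G u) (G v) w) e)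
      - sgnb (i && j) (sgnb j (conv D21 (Y2Y1 Y (G u) (G v) w) e)).
    by rewrite -JGG sgnbB; case: (i) (j) => [] [] /=; rewrite ?opprK.
  rewrite sgnbB (opprD (sgnb _ _)) addrACA -opprD conv_dx1_jacobi // opprB.
  by rewrite addrCA addrA.
- have -> : (fun d => oYY Y' u v w d (true, false)) = YY Y (G u) v w.
    by apply/funext => d; rewrite oYYE.
  by rewrite -JGu; case: (i) (j) => [] [] /=; rewrite ?opprK.
- have -> : (fun d => oYY Y' u v w d (false, true)) =
      (fun d => sgnb i (YY Y u (G v) w d)).
    apply/funext => d; rewrite oYYE /YY /=; case: ifP; rewrite ?sgnb0 //.
    by rewrite (Gder _ _ su) YDl addrC addKr; case: (i) => //=; rewrite YNl.
  rewrite sprod_sgnb; last exact: conv_finite_YY.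
  by rewrite -JGv sgnbB; case: (i) (j) => [] [] /=; rewrite ?opprK.
- by rewrite (YJ w su sv e).
Qed.

End OddProducts.

(** * Consequences of the axioms *)

Section SignSpaces.
Variables (R : realType) (s : option nat) (V : gmodule R s).
Local Notation sgn_ i := (sign_space (@gcomp R s V) i).

Lemma gmoduleP : graded_axioms (@gcomp R s V).
Proof. by case: V. Qed.

Lemma gcomp_sign k i v : gcomp k i v -> sgn_ i v.
Proof.
move=> vk; exists (fun k' => if k' == k then v else 0); split.
- by apply: sub_finite_set (finite_set1 k) => k' /=; case: (k' =P k); rewrite ?eqxx.
- by move=> k'; case: (k' =P k) => [-> //|_]; exact: comp0 gmoduleP _ _.
rewrite (@fsbigTE _ _ _ _ [fset k]%fset) ?big_seq_fset1 ?eqxx // => k'.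
by rewrite inE => /negPf ->.
Qed.

Lemma cscale_sign (c : R[i]) i v : sgn_ i v -> sgn_ i (cscale c v).
Proof.
case=> f [fin fk ->]; exists (fun k => cscale c (f k)); split.
- by apply: sub_finite_set fin => k /=; apply: contra_neq => ->; rewrite (op0r (@cscaleDr _ _ _)).
- by move=> k; apply: (compZ gmoduleP (i := false)) => //; exact: gsign_scalar.
have fX k : k \notin fset_set [set k | f k != 0]%classic -> f k = 0.
  by move=> kX; apply/eqP/negPn/negP => fk0; case/negP: kX; rewrite in_fset_set //; exact: mem_set.
rewrite (@fsbigTE _ _ _ _ (fset_set [set k | f k != 0]%classic)) //.
rewrite [RHS](@fsbigTE _ _ _ _ (fset_set [set k | f k != 0]%classic)).
  by rewrite /cscale scaler_sumr.
by move=> k /fX ->; rewrite (op0r (@cscaleDr _ _ _)).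
Qed.

Lemma cscaleK2 (v : V) : cscale 2^-1 (v + v) = v.
Proof.
have -> : v + v = cscale 2 v by rewrite -[2]/(2%:~R) cscale_int -mulr2n.
by rewrite cscaleA mulVf ?cscale1 // pnatr_eq0.
Qed.

Lemma cscaleC (c : R[i]) (a : grassmann R[i] s) (v : V) :
  cscale c (a *: v) = a *: cscale c v.
Proof. by rewrite /cscale [LHS]scalerA [RHS]scalerA gscale_central. Qed.

Lemma is_end_cscale (c : R[i]) p (T : V -> V) :
  is_end p T -> is_end p (fun v => cscale c (T v)).
Proof.
move=> [TD TZ Ts]; split.
- by move=> u v; rewrite TD cscaleDr.
- move=> i a v sa; rewrite (TZ i) // -cscaleC; case: (p && i) => //=.
  by rewrite (opNr (@cscaleDr _ _ _)).
- by move=> i v /Ts; exact: cscale_sign.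
Qed.

Lemma end_mode_addr p (Y : V -> V -> int -> V) u v v' k :
  (forall n, is_end p (mode Y u n)) -> Y u (v + v') k = Y u v k + Y u v' k.
Proof.
move=> /(_ (- k - 1))/end_add/(_ v v').
by rewrite /mode; have -> : - (- k - 1) - 1 = k by lia.
Qed.

Lemma mode_trunc (Y : V -> V -> int -> V) u v :
  (exists N : int, forall n, N <= n -> mode Y u n v = 0) ->
  exists N : int, forall k, k < N -> Y u v k = 0.
Proof.
case=> N hN; exists (- N) => k lt; have := hN (- k - 1).
rewrite /mode; have -> : - (- k - 1) - 1 = k by lia.
by apply; lia.
Qed.

(** The central term of [G(n + 1/2), G(-1/2)] vanishes for every n, so this
    relation determines all the operators L(n) from the G(n + 1/2). *)
Lemma ns_L_from_G (c : R[i]) (L G : int -> V -> V) n v : neveu_schwarz c L G ->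
  cscale 2^-1 (G n (G (-1) v) + G (-1) (G n v)) = L n v.
Proof.
move=> ns; have := ns_GG ns n 0 v; rewrite /supercomm /= opprK addr0 sub0r => ->.
rewrite [X in cscale X v](_ : _ = 0) ?(op0l (@cscaleDl _ _ _)) ?addr0; last first.
  by case: (n =P 0) => [->|_]; rewrite ?expr0n ?addr0 ?mulr0z ?mulr0 ?mul0r.
by rewrite cscaleA mulVf ?cscale1 // pnatr_eq0.
Qed.

Lemma ns_G_square (c : R[i]) (L G : int -> V -> V) v : neveu_schwarz c L G ->
  G (-1) (G (-1) v) = L (-1) v.
Proof. by move=> ns; rewrite -(ns_L_from_G _ _ ns) cscaleK2. Qed.

End SignSpaces.

(** * Setting the odd variables to zero *)

Section Forget.
Variables (R : realType) (s : option nat) (c : R[i]) (V : gmodule R s).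
Variables (Y : V -> V -> bool -> int -> V) (one tau : V).
Hypothesis H : ovosa_axioms c Y one tau.
Local Notation sgn_ i := (sign_space (@gcomp R s V) i).
Local Notation Y0 := (fun u v k => Y u v false k).
Local Notation G := (oG Y tau (-1)).

Lemma otau_sign : sgn_ true tau.
Proof. exact: gcomp_sign (o_tau H). Qed.

(** The coefficient of phi^0 in the G(-1/2)-derivative property: the whole of Y is
    recovered from its restriction to phi = 0. *)
Lemma oY_extension : Y = odd_extension G Y0.
Proof.
apply/funext => u; apply/funext => v; apply/funext => -[]; apply/funext => k //.
exact: (o_deriv H u v false k).
Qed.

Lemma oY_addr i u v v' k : sgn_ i u -> Y0 u (v + v') k = Y0 u v k + Y0 u v' k.
Proof. by move=> su; apply: end_mode_addr => n; exact: (o_imode H n su). Qed.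

Lemma oY_trunc u v : exists N : int, forall k, k < N -> Y0 u v k = 0.
Proof.
by apply: mode_trunc; have [N hN] := o_trunc H u v; exists N => n /hN[].
Qed.

Lemma oG_end : is_end true G.
Proof. exact: o_imode H _ _ _ otau_sign. Qed.

Lemma oG0 : G 0 = 0.
Proof. exact: (addmap0 (end_add oG_end)). Qed.

Lemma forget_odd_axioms : vosa_axioms c Y0 one tau.
Proof.
split.
- by move=> u u' v k; exact: o_addl H _ _ _ _ _.
- move=> a u v k; elim/homogeneous_ind: a => [|a b IHa IHb|i a sa].
  + by rewrite !scale0r (Y0l (Y := Y0)) // => *; exact: (o_addl H).
  + by rewrite !scalerDl (o_addl H) IHa IHb.
  + by rewrite (o_scalel H _ _ _ _ sa) andbF.
- by move=> i u n; exact: o_imode H _ _ _.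
- exact: o_one H.
- exact: o_tau H.
- move=> u v; have [N hN] := o_trunc H u v; exists N => n /hN; by case.
- by move=> v k; exact: o_vacuum H _ _ _.
- by move=> v; have [h ?] := o_create H v; split=> // k; exact: h.
- move=> i j u v w e su sv.
  apply: (jacobi_of_odd (G := G) (fun u u' v => o_addl H u u' v false) oY_addr oY_trunc (end_sign oG_end) su sv oG0).
  by move=> e'; have := o_jacobi H w e' su sv; rewrite {1 2 3}oY_extension.
exists (oL Y tau); split.
- move=> n; apply: is_end_cscale; exact: o_hmode H _ _ _ otau_sign.
- exact: o_ns H.
- by move=> k v; exact: o_L0 H _ _.
(* The square of d/dphi + phi d/dx is d/dx, and that of G(-1/2) is L(-1). *)
by move=> u v k; rewrite -(ns_G_square _ (o_ns H)) -(o_deriv H) /= -(o_deriv H).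
Qed.

End Forget.

(** * Adjoining the odd variables *)

Section Extend.
Variables (R : realType) (s : option nat) (c : R[i]) (V : gmodule R s).
Variables (Y : V -> V -> int -> V) (one tau : V).
Hypothesis H : vosa_axioms c Y one tau.
Local Notation C := R[i].
Local Notation sgn_ i := (sign_space (@gcomp R s V) i).
Local Notation G := (mode Y tau 0).
Local Notation Y' := (odd_extension G Y).

Lemma tau_sign : sgn_ true tau.
Proof. exact: gcomp_sign (v_tau H). Qed.

Lemma Y_addr i u v v' k : sgn_ i u -> Y u (v + v') k = Y u v k + Y u v' k.
Proof. by move=> su; apply: end_mode_addr => n; exact: (v_mode H n su). Qed.

Lemma Y_trunc u v : exists N : int, forall k, k < N -> Y u v k = 0.
Proof. exact: mode_trunc (v_trunc H u v). Qed.

Lemma G_end : is_end true G.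
Proof. exact: (v_mode H 0 tau_sign). Qed.

Lemma gbinom_small k : gbinom C k%:Z k.+1 = 0.
Proof. by rewrite /gbinom big_ord_recr /= subrr mulr0 mul0r. Qed.

(** The residue in x0 and x1 of the Jacobi identity for tau and u.  The products do
    not involve x0 and the iterate does not involve x1, which fixes one exponent of
    the delta function; the vanishing of binomials then leaves one summand in each
    of the three terms. *)
Lemma G_commutator i u w k : sgn_ i u ->
  G (Y u w k) = Y (G u) w k + sgnb i (Y u (G w) k).
Proof.
move=> su; have := v_jacobi H w (-1, -1, k) tau_sign su.
rewrite (sprod1 (@cscaleDl _ _ _) (@cscaleDr _ _ _) (d0 := (-1, 0, 0))) => [|[[d0 d1] d2]]; last first.
  rewrite /xshift /delta12_0 /Y1Y2 /= => D0; case: ifP => [|_]; last by rewrite eqxx.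
  rewrite subr_eq0 => /eqP E _; move: D0; rewrite -E.
  by rewrite bpow0 !subr0; case: (d1 =P 0) (d2 =P 0) => [->|_] [->|_]; rewrite ?eqxx.
rewrite (sprod1 (@cscaleDl _ _ _) (@cscaleDr _ _ _) (d0 := (-1, 0, 0))) => [|[[d0 d1] d2]]; last first.
  rewrite /xshift /delta21_0 /Y2Y1 /= => D0; case: ifP => [|_]; last by rewrite eqxx.
  rewrite subr_eq0 => /eqP E _; move: D0; rewrite -E.
  by rewrite bpow0 !subr0; case: (d1 =P 0) (d2 =P 0) => [->|_] [->|_]; rewrite ?mulr0 ?eqxx.
rewrite (sprod1 (@cscaleDl _ _ _) (@cscaleDr _ _ _) (d0 := (0, -1, 0))) => [|[[d0 d1] d2]]; last first.
  rewrite /xshift /delta10_2 /YY /= => D0; case: ifP => [|_]; last by rewrite eqxx.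
  rewrite subr_eq0 => /eqP E _; move: D0; rewrite -E.
  move=> D0; have [d0_ge0 sum] := bpow_neq0 D0.
  case: d0 D0 d0_ge0 sum => // -[|d0] D0 _ sum.
    by congr (_, _, _); move: sum; lia.
  move: D0; rewrite /bpow; case: ifP => [_|]; last by rewrite eqxx.
  have -> : - (d2 - -1) = d0 by lia.
  by rewrite !subr0 /= gbinom_small mulr0 eqxx.
rewrite /xshift /delta12_0 /delta21_0 /delta10_2 /Y1Y2 /Y2Y1 /YY /= !bpow0.
rewrite !subr0 subrr expr0z !eqxx mulr1 !cscale1.
have -> : bpow C (- (0 - -1)) (-1) 0 = 1.
  by rewrite /bpow /= /gbinom big_ord0 fact0 divr1 mulr1.
by rewrite cscale1 /mode oppr0 sub0r => <-; rewrite subrK.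
Qed.

(** The phi-coefficient of Y(tau, (x, phi)) is Y(G(-1/2) tau, x), which by the
    commutator formula is the anticommutator of G(-1/2) with Y(tau, x). *)
Lemma oL_extension (L : int -> V -> V) :
  neveu_schwarz c L (fun n => mode Y tau (n + 1)) -> oL Y' tau = L.
Proof.
move=> ns; apply/funext => n; apply/funext => v; rewrite -(ns_L_from_G n v ns).
rewrite /oL /hmode /odd_extension addNr; congr (cscale _ _).
rewrite -[mode Y tau (n + 1) v]/(Y tau v (- (n + 1) - 1)).
by rewrite (G_commutator _ _ tau_sign) /= [RHS]addrC subrK.
Qed.

Lemma G_sign i u : sgn_ i u -> sgn_ (~~ i) (G u).
Proof. exact: (end_sign G_end). Qed.

Lemma extend_axioms : ovosa_axioms c Y' one tau.
Proof.
have [L [_ ns L0 LD]] := v_ns H.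
have YD := v_addl H.
have Y0 v k : Y 0 v k = 0 by exact: (Y0l YD).
have GG u v k : Y u v (k + 1) *~ (k + 1) = Y (G (G u)) v k.
  by rewrite LD -(ns_G_square u ns).
split.
- move=> u u' v [] k; rewrite /odd_extension; last exact: YD.
  by rewrite (end_add G_end) YD.
- move=> i a u v [] k sa; rewrite /odd_extension; last by rewrite andbF (v_scalel H).
  rewrite (end_scale G_end u sa) andbT; case: (i) => /=; last by rewrite (v_scalel H).
  by rewrite (YNl YD) (v_scalel H).
- exact: v_mode H.
- by move=> i u n su; exact: (v_mode H n (G_sign su)).
- exact: v_one H.
- exact: v_tau H.
- move=> u v; have [N hN] := v_trunc H u v; have [N' hN'] := v_trunc H (G u) v.
  exists (Num.max N N') => n; rewrite ge_max => /andP[? ?].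
  by split; [exact: hN|exact: hN'].
- move=> v [] k; rewrite /odd_extension; last exact: v_vacuum H v k.
  rewrite [G one](_ : _ = 0); first exact: Y0.
  by rewrite /mode; apply: (v_create H tau).1.
- move=> v; split; last exact: (v_create H v).2.
  by move=> [] k k0; apply: (v_create H _).1.
- move=> i j u v w e su sv.
  apply: (odd_jacobi_extension YD Y_addr Y_trunc G_sign) => //.
  + by move=> ????? su' sv' e'; exact: (v_jacobi H _ _ su' sv').
  + exact: end_add G_end.
  + exact: G_commutator.
- by rewrite (oL_extension ns).
- by move=> k v; rewrite (oL_extension ns); exact: L0.
- move=> u v [] k //=; exact: GG.
Qed.

End Extend.

(** * The functors *)

(** Arrows with their endpoints: over equal but not convertible objects this is
    how the values of two functors on an arrow are compared. *)
Definition arrow (A : category) : Type := {p : obj A * obj A & Defs.hom p.1 p.2}.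

Definition arr (A : category) (X Y : obj A) (f : Defs.hom X Y) : arrow A :=
  existT (fun p => Defs.hom p.1 p.2) (X, Y) f.

Lemma functor_ext (A B : category) (F F' : functor A B) :
  (forall X, fobj F X = fobj F' X) ->
  (forall X Y (f : Defs.hom X Y), arr (fmap F f) = arr (fmap F' f)) -> F = F'.
Proof.
case: F F' => [o m m1 mM] [o' m' m1' mM'] /= /funext oo'.
case: _ / oo' in m' m1' mM' * => mm'.
have {}mm' : m = m'.
  apply: functional_extensionality_dep => X; apply: functional_extensionality_dep => Y.
  (* The endpoints agree up to a proof that, by uniqueness, is the reflexive one. *)
  apply/funext => f; have e := mm' X Y f.
  by rewrite -[RHS](projT2_eq e) (Prop_irrelevance (projT1_eq e) erefl).
case: _ / mm' in m1' mM' *.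
by congr Functor; exact: Prop_irrelevance.
Qed.

Section Functors.
Variables (R : realType) (s : option nat) (c : R[i]).

Lemma vosaP (V : vosa s c) : vosa_axioms c (@v_Y _ _ _ V) (v_1 V) (v_t V).
Proof. by case: V. Qed.

Lemma ovosaP (V : ovosa s c) : ovosa_axioms c (@o_Y _ _ _ V) (o_1 V) (o_t V).
Proof. by case: V. Qed.

Definition forget_odd (V : ovosa s c) : vosa s c := Vosa (forget_odd_axioms (ovosaP V)).

Definition extend_odd (V : vosa s c) : ovosa s c := OVosa (extend_axioms (vosaP V)).

Lemma forget_hom_axioms (V W : ovosa s c) (f : ovosa_hom V W) :
  @vosa_hom_axioms _ _ _ (forget_odd V) (forget_odd W) f.
Proof.
by case: f => f [fD fZ fC fY f1 ft]; split=> // u v k; exact: fY.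
Qed.

Lemma extend_hom_axioms (V W : vosa s c) (f : vosa_hom V W) :
  @ovosa_hom_axioms _ _ _ (extend_odd V) (extend_odd W) f.
Proof.
case: f => f [fD fZ fC fY f1 ft]; split=> //= u v [] k; rewrite /odd_extension fY //.
by rewrite /mode fY ft.
Qed.

Definition F0 : functor (SVphi s c) (SV s c).
Proof.
refine (@Functor (SVphi s c) (SV s c) forget_odd
  (fun V W f => VosaHom (forget_hom_axioms f)) _ _).
- by move=> V; exact: vosa_hom_eq.
- by move=> *; exact: vosa_hom_eq.
Defined.

Definition Fphi : functor (SV s c) (SVphi s c).
Proof.
refine (@Functor (SV s c) (SVphi s c) extend_odd
  (fun V W f => OVosaHom (extend_hom_axioms f)) _ _).
- by move=> V; exact: ovosa_hom_eq.
- by move=> *; exact: ovosa_hom_eq.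
Defined.

(** The axioms being propositions, an object is its underlying data and an arrow
    its underlying map. *)
Lemma arr_vosa (M N : gmodule R s) YM oM tM YN oN tN
    (pM qM : @vosa_axioms R s M c YM oM tM) (pN qN : @vosa_axioms R s N c YN oN tN)
    (f : M -> N) (pf : @vosa_hom_axioms _ _ _ (Vosa pM) (Vosa pN) f)
    (qf : @vosa_hom_axioms _ _ _ (Vosa qM) (Vosa qN) f) :
  arr (A := SV s c) (VosaHom pf) = arr (A := SV s c) (VosaHom qf).
Proof.
case: _ / (Prop_irrelevance pM qM) in qf *; case: _ / (Prop_irrelevance pN qN) in qf *.
by rewrite (Prop_irrelevance pf qf).
Qed.

Lemma arr_ovosa (M N : gmodule R s) YM YM' oM tM YN YN' oN tN
    (pM : @ovosa_axioms R s M c YM oM tM) (qM : @ovosa_axioms R s M c YM' oM tM)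
    (pN : @ovosa_axioms R s N c YN oN tN) (qN : @ovosa_axioms R s N c YN' oN tN)
    (f : M -> N) (pf : @ovosa_hom_axioms _ _ _ (OVosa pM) (OVosa pN) f)
    (qf : @ovosa_hom_axioms _ _ _ (OVosa qM) (OVosa qN) f) :
  YM = YM' -> YN = YN' ->
  arr (A := SVphi s c) (OVosaHom pf) = arr (A := SVphi s c) (OVosaHom qf).
Proof.
move=> eM eN; case: _ / eM in qM qf *; case: _ / eN in qN qf *.
case: _ / (Prop_irrelevance pM qM) in qf *; case: _ / (Prop_irrelevance pN qN) in qf *.
by rewrite (Prop_irrelevance pf qf).
Qed.

(** The restriction to phi = 0 of the extension is convertible to Y, so the
    two objects differ at most in the proofs of the axioms. *)
Lemma forget_extend : functor_comp F0 Fphi = functor_id (SV s c).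
Proof.
apply: functor_ext => [[V Y o t p]|[V Y o t p] [W Y' o' t' p'] [f pf]] /=.
  by congr Vosa; exact: Prop_irrelevance.
exact: arr_vosa.
Qed.

(** Conversely oY_extension supplies the equality of the vertex operators. *)
Lemma extend_forget : functor_comp Fphi F0 = functor_id (SVphi s c).
Proof.
apply: functor_ext => [[V Y o t p]|[V Y o t p] [W Y' o' t' p'] [f pf]] /=.
  rewrite /extend_odd /=; move: (extend_axioms _) => /=.
  have -> : odd_extension (mode (fun u v k => Y u v false k) t 0) (fun u v k => Y u v false k) = Y.
    exact: (esym (oY_extension p)).
  by move=> q; congr OVosa; exact: Prop_irrelevance.
by apply: arr_ovosa; [exact: (esym (oY_extension p)) | exact: (esym (oY_extension p'))].
Qed.

End Functors.

Theorem theorem6p3 (R : realType) (s : option nat) (c : complex R) :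
  exists (F0 : functor (SVphi s c) (SV s c)) (Fphi : functor (SV s c) (SVphi s c)),
    functor_comp F0 Fphi = functor_id (SV s c) /\
    functor_comp Fphi F0 = functor_id (SVphi s c).
Proof.
by exists (F0 s c), (Fphi s c); split; [exact: forget_extend | exact: extend_forget].
Qed.
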